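(* Let $f=\frac1n\sum_{i=1}^n f^i$ on $\mathbb{R}^d$ with $f^i(x)=\mathbb{E}_{\xi_i\sim\mathcal{D}_i}[F^i(x,\xi_i)]$, where each $f^i$ is $L$-Lipschitz and has $L_1$-Lipschitz gradient. Assume: (i) the network is connected and $P\in\mathbb{R}^{n\times n}$ is symmetric and doubly stochastic (with entries in $[0,1]$), with second largest singular value $\rho\in[0,1)$; (ii) each $f^i$ is bounded below, and $f(\bar x_0)-\inf_x f(x)\le\gamma$, where $\bar x_0$ is the average of the agents' initial points (here $\bar x_0=0$); (iii) for all $x\in\mathbb{R}^d$ and $i\in[n]$: $\mathbb{E}[\nabla F^i(x,\xi)]=\nabla f^i(x)$, $\mathbb{E}[\|\nabla F^i(x,\xi)-\nabla f^i(x)\|^2]\le\sigma^2$ and $\mathbb{E}[\|\nabla F^i(x,\xi)\|^2]\le G^2$. Let $\delta,\epsilon\in(0,1)$. Then one can choose positive integers $K,T$ and a learning rate $\eta>0$ with $$N:=KT=\Theta\big(\delta^{-1}\epsilon^{-3}(1-\rho)^{-2}\big),\quad T=\Theta\big((1-\rho)^{1/3}(\delta N)^{2/3}\big),\quad D=\frac{\delta(1-\rho)}{2T\sqrt n},\quad \eta=\Theta\Big(\sqrt{1-\rho}\,\frac{D}{\sqrt T}\Big),$$ such that running the algorithm ME-DOL (defined in the context) with first-order oracle and smoothing parameter $\delta'=0$ for $N$ rounds ($K$ epochs of length $T$) produces points $\bar w^1,\dots,\bar w^K$ satisfying $$\mathbb{E}_{k\sim \mathrm{unif}[K]}\big[\|\nabla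 f(\bar w^k)\|_\delta\big]\le\epsilon .$$
   Context: Notation. $[n]=\{1,\dots,n\}$; $\|\cdot\|$ is the Euclidean norm; $B(x,r)=\{y\in\mathbb{R}^d:\|y-x\|\le r\}$; $\mathrm{unif}(A)$ is the uniform distribution on $A$. For Lipschitz $f:\mathbb{R}^d\to\mathbb{R}$, the Clarke subdifferential is $\partial f(x)=\mathrm{conv}\{g: g=\lim_{x_s\to x}\nabla f(x_s)\}$ (limits along sequences of differentiability points), the Goldstein $\delta$-subdifferential is $\partial_\delta f(x)=\mathrm{conv}\big(\bigcup_{y\in B(x,\delta)}\partial f(y)\big)$, and $\|\nabla f(x)\|_\delta:=\min\{\|g\|:g\in\partial_\delta f(x)\}$. A point is $(\delta,\epsilon)$-stationary if $\|\nabla f(x)\|_\delta\le\epsilon$. $\Theta(\cdot)$ hides positive constants that may depend on the problem parameters $n,d,L,L_1,G,\sigma,\gamma$ but not on $\delta,\epsilon,\rho,N$. Algorithm ME-DOL (first-order oracle, smoothing parameter $\delta'\ge0$). Inputs: $K,T$, $P$, $\eta$, and the action domain $\mathcal{D}=B(0,D)\subset\mathbb{R}^d$. Initialize $y^0_{T,i}=0$ for all $i\in[n]$. For each epoch $k=1,\dots,K$: set $y^k_{0,i}=y^{k-1}_{T,i}$, and restart the online algorithm: $\Delta^k_{1/2,i}=0$, $g^k_{0,i}=0$ for all $i$. For $t=1,\dots,T$ and all $i\in[n]$: - $\Delta^k_{t,i}=\operatorname{argmin}_{\Delta\in\mathcal{D}}\{\eta\langle\Delta,g^k_{t-1,i}\rangle+\frac12\|\Delta-\Delta^k_{t-1/2,i}\|^2\}$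 and $\Delta^k_{t+1/2,i}=\sum_{j=1}^nP_{ij}\Delta^k_{t,j}$; - $x^k_{t,i}=y^k_{t-1,i}+\Delta^k_{t,i}$; - sample $s^k_{t,i}\sim\mathrm{unif}[0,1]$ and set $w^k_{t,i}=y^k_{t-1,i}+s^k_{t,i}\Delta^k_{t,i}$; - $y^k_{t,i}=\sum_{j=1}^nP_{ij}x^k_{t,j}$; - sample $z^k_{t,i}\sim\mathrm{unif}(B(0,1))$ and $\xi^k_{t,i}\sim\mathcal{D}_i$ and set $g^k_{t,i}=\nabla F^i(w^k_{t,i}+\delta' z^k_{t,i},\xi^k_{t,i})$. At the end of epoch $k$ set $\bar w^k=\frac1{nT}\sum_{i=1}^n\sum_{t=1}^Tw^k_{t,i}$. The output is a uniformly random element of $\{\bar w^1,\dots,\bar w^K\}$. All random draws $s^k_{t,i},z^k_{t,i},\xi^k_{t,i}$ are independent. The expectation $\mathbb{E}_{k\sim\mathrm{unif}[K]}$ is over the uniform index $k$ and all the randomness of the algorithm. *)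

(* Defs.v *)
From HB Require Import structures.
From mathcomp Require Import all_boot all_order all_algebra.
From mathcomp Require Import all_classical all_reals all_analysis.

Set Implicit Arguments.
Unset Strict Implicit.
Unset Printing Implicit Defensive.

Import Order.TTheory GRing.Theory Num.Theory.
Import numFieldNormedType.Exports.

Local Open Scope classical_set_scope.
Local Open Scope ring_scope.

(* The library norm on ['rV[R]_d] is the sup norm, hence a separate Euclidean
   norm; both induce the same topology, so the library's [differentiable] and
   [-->] are used as they are. *)
Definition dotp (R : realType) (d : nat) (x y : 'rV[R]_d) : R :=
  \sum_(j < d) x 0 j * y 0 j.

Definition enorm (R : realType) (d : nat) (x : 'rV[R]_d) : R :=
  Num.sqrt (dotp x x).

Definition eball (R : realType) (d : nat) (x : 'rV[R]_d) (r : R) :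
    set 'rV[R]_d :=
  [set y | enorm (y - x) <= r].

(* Meaningful where [f] is differentiable. *)
Definition grad (R : realType) (d : nat) (f : 'rV[R]_d -> R) (x : 'rV[R]_d) :
    'rV[R]_d :=
  \row_(j < d) 'D_(delta_mx 0 j) f x.

Definition elipschitz (R : realType) (d : nat) (L : R) (f : 'rV[R]_d -> R) :
    Prop :=
  forall x y, `|f x - f y| <= L * enorm (x - y).

Definition smooth (R : realType) (d : nat) (L1 : R) (f : 'rV[R]_d -> R) :
    Prop :=
  (forall x, differentiable f x) /\
  (forall x y, enorm (grad f x - grad f y) <= L1 * enorm (x - y)).

Definition conv_hull (R : realType) (d : nat) (A : set 'rV[R]_d) :
    set 'rV[R]_d :=
  [set g | exists (m : nat) (a : 'I_m -> R) (v : 'I_m -> 'rV[R]_d),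
     [/\ forall i, 0 <= a i,
         \sum_(i < m) a i = 1,
         forall i, A (v i) &
         g = \sum_(i < m) a i *: v i]].

Definition clarke (R : realType) (d : nat) (f : 'rV[R]_d -> R)
    (x : 'rV[R]_d) : set 'rV[R]_d :=
  conv_hull [set g | exists u : nat -> 'rV[R]_d,
     [/\ forall m, differentiable f (u m),
         u @ \oo --> x &
         grad f \o u @ \oo --> g]].

Definition goldstein (R : realType) (d : nat) (f : 'rV[R]_d -> R) (delta : R)
    (x : 'rV[R]_d) : set 'rV[R]_d :=
  conv_hull (\bigcup_(y in eball x delta) clarke f y).

(* For Lipschitz [f] the Goldstein subdifferential is nonempty and compact, so
   the infimum is a minimum. *)
Definition goldstein_norm (R : realType) (d : nat) (f : 'rV[R]_d -> R)
    (delta : R) (x : 'rV[R]_d) : R :=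
  inf [set enorm g | g in goldstein f delta x].

Definition doubly_stochastic (R : realType) (n : nat) (P : 'M[R]_n) : Prop :=
  [/\ forall i j, 0 <= P i j <= 1,
      forall i, \sum_(j < n) P i j = 1 &
      forall j, \sum_(i < n) P i j = 1].

(* The communication network of [P] links distinct agents [i] and [j] when
   [P i j > 0]. *)
Definition network (R : realType) (n : nat) (P : 'M[R]_n) : rel 'I_n :=
  [rel i j | (i != j) && (0 < P i j)].

Definition connected_network (R : realType) (n : nat) (P : 'M[R]_n) : Prop :=
  forall i j, connect (network P) i j.

(* Square roots of the eigenvalues of A^T A, counted with multiplicity, in
   nonincreasing order. *)
Definition singular_values (R : realType) (n : nat) (A : 'M[R]_n)
    (s : seq R) : Prop :=
  [/\ sorted (fun a b => b <= a) s,
      all (fun a => 0 <= a) s &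
      char_poly (A^T *m A) = \prod_(a <- s) ('X - (a ^+ 2)%:P)].

(* Out-of-range entries of a sequence are 0: the value is 0 when n = 1. *)
Definition second_singular_value (R : realType) (n : nat) (A : 'M[R]_n)
    (rho : R) : Prop :=
  exists2 s, singular_values A s & rho = s`_1.

Definition argmin (R : realType) (d : nat) (A : set 'rV[R]_d)
    (h : 'rV[R]_d -> R) : 'rV[R]_d :=
  xget 0 [set x | A x /\ forall y, A y -> h x <= h y].

(* After step t of an epoch: [st_y] is y_t, [st_Dhalf] is Delta_{t+1/2},
   [st_g] is g_t and [st_w] is w_t (irrelevant for t = 0). *)
Record state (R : realType) (n d : nat) := State {
  st_y : 'I_n -> 'rV[R]_d;
  st_Dhalf : 'I_n -> 'rV[R]_d;
  st_g : 'I_n -> 'rV[R]_d;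
  st_w : 'I_n -> 'rV[R]_d }.

Definition step (R : realType) (n d : nat) (X : 'I_n -> Type) (P : 'M[R]_n)
    (D eta delta' : R) (F : forall i, 'rV[R]_d -> X i -> R)
    (s : 'I_n -> R) (z : 'I_n -> 'rV[R]_d) (xi : forall i, X i)
    (S : state R n d) : state R n d :=
  let Delta i := argmin (eball 0 D) (fun v =>
    eta * dotp v (st_g S i) + 2^-1 * enorm (v - st_Dhalf S i) ^+ 2) in
  let x i := st_y S i + Delta i in
  let w i := st_y S i + s i *: Delta i in
  {| st_y := fun i => \sum_(j < n) P i j *: x j;
     st_Dhalf := fun i => \sum_(j < n) P i j *: Delta j;
     st_g := fun i => grad (F i ^~ (xi i)) (w i + delta' *: z i);
     st_w := w |}.

(* Epochs and steps are numbered from 0: [s k t], [z k t], [xi k t] are the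
   draws of step t+1 in epoch k+1. *)
Fixpoint epoch (R : realType) (n d : nat) (X : 'I_n -> Type) (P : 'M[R]_n)
    (D eta delta' : R) (F : forall i, 'rV[R]_d -> X i -> R)
    (s : nat -> 'I_n -> R) (z : nat -> 'I_n -> 'rV[R]_d)
    (xi : nat -> forall i, X i) (y0 : 'I_n -> 'rV[R]_d) (t : nat) :
    state R n d :=
  if t is t'.+1 then
    step P D eta delta' F (s t') (z t') (xi t')
      (epoch P D eta delta' F s z xi y0 t')
  else {| st_y := y0; st_Dhalf := fun=> 0; st_g := fun=> 0; st_w := y0 |}.

Fixpoint epoch_start (R : realType) (n d : nat) (X : 'I_n -> Type)
    (P : 'M[R]_n) (D eta delta' : R) (F : forall i, 'rV[R]_d -> X i -> R)
    (s : nat -> nat -> 'I_n -> R) (z : nat -> nat -> 'I_n -> 'rV[R]_d)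
    (xi : nat -> nat -> forall i, X i) (T : nat) (k : nat) :
    'I_n -> 'rV[R]_d :=
  if k is k'.+1 then
    st_y (epoch P D eta delta' F (s k') (z k') (xi k')
         (epoch_start P D eta delta' F s z xi T k') T)
  else fun=> 0.

Definition me_dol_wbar (R : realType) (n d : nat) (X : 'I_n -> Type)
    (P : 'M[R]_n) (D eta delta' : R) (F : forall i, 'rV[R]_d -> X i -> R)
    (s : nat -> nat -> 'I_n -> R) (z : nat -> nat -> 'I_n -> 'rV[R]_d)
    (xi : nat -> nat -> forall i, X i) (T : nat) (k : nat) : 'rV[R]_d :=
  ((n * T)%:R)^-1 *: \sum_(i < n) \sum_(t < T)
    st_w (epoch P D eta delta' F (s k) (z k) (xi k)
         (epoch_start P D eta delta' F s z xi T k) t.+1) i.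

Definition has_law (R : realType) (dO dX : measure_display)
    (Om : measurableType dO) (X : measurableType dX) (Pr : probability Om R)
    (V : Om -> X) (mu : set X -> \bar R) : Prop :=
  forall A, measurable A -> Pr (V @^-1` A) = mu A.

(* Mutual independence of sigma-algebras; since each contains [setT], the
   product rule over the whole family covers the subfamilies. *)
Definition independent_sigma (R : realType) (dO : measure_display)
    (Om : measurableType dO) (Pr : probability Om R) (J : finType)
    (H : J -> set (set Om)) : Prop :=
  forall E : J -> set Om, (forall j, H j (E j)) ->
    Pr (\bigcap_(j in [set: J]) E j) = (\prod_(j : J) fine (Pr (E j)))%:E.

Definition draw_sigma (R : realType) (n K T : nat) (dO : measure_display)
    (Om : measurableType dO) (dX : 'I_n -> measure_display)
    (X : forall i, measurableType (dX i))
    (s : nat -> nat -> 'I_n -> Om -> R)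
    (xi : nat -> nat -> forall i, Om -> X i)
    (j : 'I_K * 'I_T * 'I_n + 'I_K * 'I_T * 'I_n) : set (set Om) :=
  match j with
  | inl (k, t, i) => preimage_set_system setT (s k t i) measurable
  | inr (k, t, i) => preimage_set_system setT (xi k t i) measurable
  end.

Definition theta_between (R : realType) (c C a b : R) : Prop :=
  c * b <= a <= C * b.

(* Main.v *)
Require Import Defs.
From HB Require Import structures.
From mathcomp Require Import all_boot all_order all_algebra.
From mathcomp Require Import all_classical all_reals all_analysis.
From mathcomp Require Import measurable_realfun.
From mathcomp Require Import ring lra complex.

Import Order.TTheory GRing.Theory Num.Theory.
Import numFieldNormedType.Exports.

Local Open Scope classical_set_scope.
Local Open Scope ring_scope.

(** The run is a decentralised online-to-nonconvex conversion. Let ybar be the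
    average of the agents' iterates. Gossip with a doubly stochastic matrix
    leaves averages unchanged, so ybar moves exactly by the averaged action, and
    f decreases, up to O(L1 D^2), by minus the inner product of its gradient at
    ybar with that action ([smooth_descent]). Let v be the sum of these gradients
    over one epoch. Playing u = - D v / |v| all along would decrease f by D |v|;
    hence D |v| is at most the actual decrease of f, plus the regret of the
    learner against u, plus the price of evaluating stochastic gradients at the
    agents' query points instead of exact ones at ybar ([epoch_bound]). The
    decreases telescope over the epochs and add up to at most gamma. On the other
    hand v / T is a Goldstein subgradient of f at wbar, because nothing moves
    farther than T D + sqrt n D / (1 - rho) <= delta within an epoch
    ([wbar_near], [goldstein_norm_avg]).

    Three quantities remain to be estimated.

    Disagreement. One round of gossip shrinks deviations from the average by rho
    ([spread_mix]): deflating the eigenvalue 1 of the constant vector leaves the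
    other squared singular values as the spectrum ([char_poly_deflate]), and these
    control a symmetric matrix ([sym_opnorm]). By convexity of the square, squared
    deviations satisfy linear recursions, so the agents stay in a tube of radius
    sqrt n D / (1 - rho) around ybar ([w_near_ybar]). Since the gradients are
    Lipschitz, all the points queried in a round are interchangeable up to
    L1 times this radius.

    Regret. The squared distance of the actions to u plus their disagreement is a
    Lyapunov function ([regret_step]); summing its decrements bounds the regret by
    O(D^2 / eta + eta T G^2 / (1 - rho)).

    Noise. The gap m between exact and stochastic gradients enters through its
    inner product with the averaged action and through the norm of its sum over
    the epoch. Bounding that norm by its square and expanding the square leaves
    second moments of m and inner products of m with vectors determined before the
    sample is drawn ([noise_sum_sqr]). The latter have mean zero
    ([noise_orthogonal]): all the other draws generate a sigma-algebra independent
    of the current sample ([others_independent]), so the sample can be integrated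
    out with the past frozen ([integral_fresh]).

    With T of order eps^-2 (1 - rho)^-1 and K of order
    delta^-1 eps^-1 (1 - rho)^-1, every error term is a small multiple of
    eps ([error_budget]). *)

Set Implicit Arguments.
Unset Strict Implicit.
Unset Printing Implicit Defensive.

(** * Euclidean geometry and projection onto a ball *)

Section Euclid.
Context (R : realType) (d : nat).
Implicit Types (x y z u v : 'rV[R]_d) (a b D : R).

Lemma dotpC x y : dotp x y = dotp y x.
Proof. by apply: eq_bigr => j _; rewrite mulrC. Qed.

Lemma dotpDl x y z : dotp (x + y) z = dotp x z + dotp y z.
Proof. by rewrite -big_split /=; apply: eq_bigr => j _; rewrite mxE mulrDl. Qed.

Lemma dotpZl a x y : dotp (a *: x) y = a * dotp x y.
Proof. by rewrite mulr_sumr; apply: eq_bigr => j _; rewrite mxE mulrA. Qed.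

Lemma dotpNl x y : dotp (- x) y = - dotp x y.
Proof. by rewrite -scaleN1r dotpZl mulN1r. Qed.

Lemma dotpBl x y z : dotp (x - y) z = dotp x z - dotp y z.
Proof. by rewrite dotpDl dotpNl. Qed.

Lemma dotp0l x : dotp 0 x = 0.
Proof. by rewrite -(scale0r 0) dotpZl mul0r. Qed.

Lemma dotpDr x y z : dotp x (y + z) = dotp x y + dotp x z.
Proof. by rewrite dotpC dotpDl !(dotpC x). Qed.

Lemma dotpZr a x y : dotp x (a *: y) = a * dotp x y.
Proof. by rewrite dotpC dotpZl dotpC. Qed.

Lemma dotpNr x y : dotp x (- y) = - dotp x y.
Proof. by rewrite dotpC dotpNl dotpC. Qed.

Lemma dotpBr x y z : dotp x (y - z) = dotp x y - dotp x z.
Proof. by rewrite dotpDr dotpNr. Qed.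

Lemma dotp0r x : dotp x 0 = 0.
Proof. by rewrite dotpC dotp0l. Qed.

Definition dotpE := (dotpDl, dotpBl, dotpZl, dotpNl, dotp0l,
  dotpDr, dotpBr, dotpZr, dotpNr, dotp0r).

Lemma dotp_suml (I : Type) (r : seq I) (Q : pred I) (V : I -> 'rV[R]_d) y :
  dotp (\sum_(i <- r | Q i) V i) y = \sum_(i <- r | Q i) dotp (V i) y.
Proof.
by elim/big_rec2: _ => [|i a v _ <-]; rewrite ?dotp0l ?dotpDl.
Qed.

Lemma dotp_ge0 x : 0 <= dotp x x.
Proof. by apply: sumr_ge0 => j _; rewrite -expr2 sqr_ge0. Qed.

Lemma dotp_eq0 x : dotp x x = 0 -> x = 0.
Proof.
move=> /eqP; rewrite psumr_eq0 => [/allP h|j _]; last by rewrite -expr2 sqr_ge0.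
apply/rowP => j; have := h j (mem_index_enum j).
by rewrite mxE -expr2 sqrf_eq0 => /eqP.
Qed.

Lemma enorm_ge0 x : 0 <= enorm x.
Proof. exact: sqrtr_ge0. Qed.

Lemma enorm_sqr x : enorm x ^+ 2 = dotp x x.
Proof. by rewrite sqr_sqrtr ?dotp_ge0. Qed.

Lemma enorm0 : enorm (0 : 'rV[R]_d) = 0.
Proof. by rewrite /enorm dotp0l sqrtr0. Qed.

Lemma enormZ a x : enorm (a *: x) = `|a| * enorm x.
Proof. by rewrite /enorm dotpZl dotpZr mulrA -expr2 sqrtrM ?sqr_ge0 // sqrtr_sqr. Qed.

Lemma enormN x : enorm (- x) = enorm x.
Proof. by rewrite -scaleN1r enormZ normrN1 mul1r. Qed.

Lemma enormC x y : enorm (x - y) = enorm (y - x).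
Proof. by rewrite -enormN opprB. Qed.

Lemma enorm_le x D : 0 <= D -> dotp x x <= D ^+ 2 -> enorm x <= D.
Proof.
by move=> D0 h; rewrite -(@ler_pXn2r _ 2) ?nnegrE ?enorm_ge0 // enorm_sqr.
Qed.

Lemma dotp_le_sqr x D : enorm x <= D -> dotp x x <= D ^+ 2.
Proof.
move=> h; rewrite -enorm_sqr ler_pXn2r ?nnegrE ?enorm_ge0 //.
exact: le_trans (enorm_ge0 _) h.
Qed.

Lemma dotp_CS x y : dotp x y <= enorm x * enorm y.
Proof.
have [y0|y0] := eqVneq (enorm y) 0.
  have -> : y = 0 by apply: dotp_eq0; rewrite -enorm_sqr y0 expr0n.
  by rewrite dotp0r enorm0 mulr0.
have [x0|x0] := eqVneq (enorm x) 0.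
  have -> : x = 0 by apply: dotp_eq0; rewrite -enorm_sqr x0 expr0n.
  by rewrite dotp0l enorm0 mul0r.
have hx : 0 < enorm x by rewrite lt_def x0 enorm_ge0.
have hy : 0 < enorm y by rewrite lt_def y0 enorm_ge0.
have := dotp_ge0 (enorm y *: x - enorm x *: y).
rewrite !dotpE -!enorm_sqr (dotpC y x) => h.
have : 0 < 2 * enorm x * enorm y by rewrite !mulr_gt0.
move: h; set a := enorm x; set b := enorm y; set c := dotp x y => h ab.
have : 0 <= (2 * a * b) * (a * b - c) by nra.
by rewrite pmulr_rge0 // subr_ge0.
Qed.

Lemma enormD x y : enorm (x + y) <= enorm x + enorm y.
Proof.
apply: enorm_le; first by rewrite addr_ge0 ?enorm_ge0.
rewrite !dotpE (dotpC y x) sqrrD !enorm_sqr.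
by have := dotp_CS x y; set a := enorm x; set b := enorm y; lra.
Qed.

Lemma enorm_dist x y z : enorm (x - z) <= enorm (x - y) + enorm (y - z).
Proof. by rewrite -[x - z](subrKA y) enormD. Qed.

Lemma enorm_sum (I : Type) (r : seq I) (Q : pred I) (V : I -> 'rV[R]_d) :
  enorm (\sum_(i <- r | Q i) V i) <= \sum_(i <- r | Q i) enorm (V i).
Proof.
elim/big_ind2: _ => [|x1 x2 y1 y2 h1 h2|//]; first by rewrite enorm0.
exact: le_trans (enormD _ _) (lerD h1 h2).
Qed.

(** Convexity of the squared norm, in the form that turns a contraction by the
    factor [a] plus a perturbation into a recursion without square roots. *)
Lemma dotp_convex a x y : 0 < a < 1 ->
  dotp (x + y) (x + y) <= a^-1 * dotp x x + (1 - a)^-1 * dotp y y.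
Proof.
move=> /andP[a0 a1]; have b0 : 0 < 1 - a by rewrite subr_gt0.
have h := dotp_ge0 ((1 - a) *: x - a *: y).
have e : a^-1 * dotp x x + (1 - a)^-1 * dotp y y - dotp (x + y) (x + y) =
  (a * (1 - a))^-1 * dotp ((1 - a) *: x - a *: y) ((1 - a) *: x - a *: y).
  rewrite !dotpE (dotpC y x); field.
  by rewrite (lt0r_neq0 a0) (lt0r_neq0 b0).
by rewrite -subr_ge0 e mulr_ge0 // invr_ge0 mulr_ge0 // ltW.
Qed.

Lemma dotp_young a x y : 0 < a ->
  dotp x y <= a / 2 * dotp x x + (2 * a)^-1 * dotp y y.
Proof.
move=> a0; have h := dotp_ge0 (a *: x - y).
have e : a / 2 * dotp x x + (2 * a)^-1 * dotp y y - dotp x y =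
  (2 * a)^-1 * dotp (a *: x - y) (a *: x - y).
  by rewrite !dotpE (dotpC y x); field; rewrite (lt0r_neq0 a0).
by rewrite -subr_ge0 e mulr_ge0 // invr_ge0 mulr_ge0 // ltW.
Qed.

Lemma dotpD_le2 x y : dotp (x + y) (x + y) <= 2 * dotp x x + 2 * dotp y y.
Proof. by have := dotp_ge0 (x - y); rewrite !dotpE (dotpC y x); lra. Qed.

(** Scaling by [D / max D |x|] is the metric projection onto the ball, written
    without a case distinction and without dividing by zero. *)
Definition proj D x : 'rV[R]_d := (D / Num.max D (enorm x)) *: x.

Lemma proj_in D x : 0 < D -> enorm (proj D x) <= D.
Proof.
move=> D0; have m0 : 0 < Num.max D (enorm x) by rewrite lt_max D0.
rewrite enormZ ger0_norm ?divr_ge0 ?(ltW D0) ?(ltW m0) //.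
by rewrite mulrAC ler_pdivrMr // ler_pM2l // le_max lexx orbT.
Qed.

Lemma proj_obtuse D x u : 0 < D -> enorm u <= D ->
  dotp (x - proj D x) (u - proj D x) <= 0.
Proof.
move=> D0 uD; rewrite /proj; have [xD|xD] := leP (enorm x) D.
  by rewrite divff ?lt0r_neq0 // scale1r subrr dotp0l.
have x0 : 0 < enorm x by exact: lt_trans xD.
have h := dotp_CS x u; set a := D / enorm x.
have a1 : a <= 1 by rewrite ler_pdivrMr // mul1r ltW.
have -> : x - a *: x = (1 - a) *: x by rewrite scalerBl scale1r.
rewrite dotpZl mulr_ge0_le0 ?subr_ge0 // dotpBr dotpZr -enorm_sqr subr_le0.
apply: le_trans h _.
have -> : a * enorm x ^+ 2 = enorm x * D by rewrite /a; field; rewrite lt0r_neq0.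
by rewrite ler_pM2l.
Qed.

Lemma proj_nonexpansive D x u : 0 < D -> enorm u <= D ->
  dotp (proj D x - u) (proj D x - u) <= dotp (x - u) (x - u).
Proof.
move=> D0 uD; have := proj_obtuse x D0 uD; have := dotp_ge0 (x - proj D x).
set p := proj D x; move=> h0 h1.
have -> : x - u = (x - p) - (u - p) by rewrite opprB addrA subrK.
have -> : p - u = - (u - p) by rewrite opprB.
by move: (x - p) (u - p) h0 h1 => a b h0 h1; rewrite !dotpE (dotpC b a); lra.
Qed.

(** Completing the square turns the objective of the online update into
    [|v - (p - eta g)|^2 / 2] up to a constant. *)
Lemma argmin_proj D (eta : R) g p : 0 < D ->
  argmin (eball 0 D) (fun v => eta * dotp v g + 2^-1 * enorm (v - p) ^+ 2)
    = proj D (p - eta *: g).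
Proof.
move=> D0; set h := (fun v => _).
have qin : enorm (proj D (p - eta *: g)) <= D by exact: proj_in.
set q := proj D _ in qin *.
have key v : enorm v <= D -> h q + 2^-1 * dotp (v - q) (v - q) <= h v.
  move=> vD; have := proj_obtuse (p - eta *: g) D0 vD.
  rewrite -/q /h !enorm_sqr; clearbody q.
  rewrite !dotpE (dotpC p v) (dotpC q v) (dotpC p q) (dotpC g v) (dotpC g q).
  lra.
rewrite /argmin; case: xgetP => [v _ [vD vmin]|none].
  have kv : h q + 2^-1 * dotp (v - q) (v - q) <= h v.
    by apply: key; rewrite -[v]subr0.
  have vq : h v <= h q by apply: vmin; rewrite /eball /= subr0.
  have v0 : dotp (v - q) (v - q) = 0.
    by apply/eqP; rewrite eq_le dotp_ge0 andbT; move: kv vq; lra.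
  by apply/eqP; rewrite -subr_eq0; apply/eqP/dotp_eq0.
exfalso; apply: (none q); split; first by rewrite /eball /= subr0.
move=> v; rewrite /eball /= subr0 => /key; apply: le_trans.
by rewrite lerDl mulr_ge0 ?dotp_ge0.
Qed.

End Euclid.

(** * Spectral gap of the gossip matrix *)

Section Spectral.
Local Open Scope complex_scope.
Local Open Scope sesquilinear_scope.

(** Diagonalising over the complex closure: the eigenvalues of a real symmetric
    matrix are real, and in an orthonormal eigenbasis the squared norm is
    multiplied coordinatewise by their squares. *)
Lemma sym_opnorm (R : realType) n (M : 'M[R]_n) (r : R) : M^T = M ->
  (forall a, eigenvalue M a -> a ^+ 2 <= r) ->
  forall u : 'rV[R]_n, dotp (u *m M) (u *m M) <= r * dotp u u.
Proof.
move=> Msym Mr u; pose iota : {rmorphism R -> R[i]} := real_complex R.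
pose MC := map_mx iota M.
have Mherm : MC \is hermsymmx.
  apply: realsym_hermsym.
    apply/is_hermitianmxP; rewrite expr0 scale1r; apply/matrixP => i j.
    by rewrite !mxE -[in LHS]Msym mxE.
  by apply/mxOverP => i j; rewrite mxE; apply/complex_realP; exists (M i j).
have [U [D [Uuni Dreal MCE]]] : exists (U : 'M[R[i]]_n) (D : 'rV[R[i]]_n),
    [/\ U \is unitarymx, D \is a mxOver Num.real &
        MC = invmx U *m diag_mx D *m U].
  exists (spectralmx MC), (spectral_diag MC); split.
  - exact: spectral_unitarymx.
  - exact: hermitian_spectral_diag_real.
  - exact/orthomx_spectralP/hermitian_normalmx.
have Uu : U \in unitmx by exact: unitarymx_unit.
have UM : U *m MC = diag_mx D *m U by have := congr1 (mulmx U) MCE; rewrite !mulmxA mulmxV // mul1mx.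
have sqnE (v : 'rV[R[i]]_n) : (v *m v ^t*) 0 0 = \sum_j `|v 0 j| ^+ 2.
  by rewrite mxE; apply: eq_bigr => j _; rewrite !mxE normCK.
have sqnU (v : 'rV[R[i]]_n) : \sum_j `|(v *m U) 0 j| ^+ 2 = \sum_j `|v 0 j| ^+ 2.
  rewrite -!sqnE trmx_mul map_mxM mulmxA -[v *m U *m _]mulmxA.
  by rewrite (unitarymxP Uuni) mulmx1.
have sqnR (v : 'rV[R]_n) : \sum_j `|map_mx iota v 0 j| ^+ 2 = iota (dotp v v).
  rewrite /dotp rmorph_sum; apply: eq_bigr => j _.
  by rewrite !mxE normc_def /= expr0n addr0 sqrtr_sqr rmorphM -expr2 -!rmorphXn /= real_normK ?num_real.
pose x := map_mx iota u *m invmx U.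
have uE : map_mx iota u = x *m U by rewrite /x mulmxKV.
have uME : map_mx iota (u *m M) = (x *m diag_mx D) *m U.
  by rewrite map_mxM -/MC uE -!mulmxA UM.
have Dr j : `|D 0 j| ^+ 2 <= iota r.
  have /complex_realP [a Da] : D 0 j \is Num.real by exact: (mxOverP Dreal).
  have ev : eigenvalue M a.
    rewrite eigenvalue_root_char -(fmorph_root iota) map_char_poly -/MC.
    rewrite -eigenvalue_root_char; apply/eigenvalueP.
    exists (delta_mx 0 j *m U).
      rewrite -mulmxA UM mulmxA scalemxAl; congr (_ *m U).
      by rewrite -rowE row_diag_mx Da.
    apply: contra_neq (_ : (delta_mx 0 j : 'rV[R[i]]_n) != 0).
      by move=> e; rewrite -(mulmxK Uu (delta_mx 0 j)) e mul0mx.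
    apply/eqP => /matrixP /(_ 0 j); rewrite !mxE !eqxx /= => /eqP.
    by rewrite oner_eq0.
  rewrite Da normc_def /= expr0n addr0 sqrtr_sqr -rmorphXn /= real_normK ?num_real //.
  by rewrite lecR Mr.
have : iota (dotp (u *m M) (u *m M)) <= iota (r * dotp u u).
  rewrite rmorphM /= -!sqnR uME uE !sqnU mulr_sumr.
  apply: ler_sum => j _; rewrite mul_mx_diag mxE normrM exprMn mulrC.
  by rewrite ler_wpM2r // exprn_ge0.
by rewrite lecR.
Qed.

End Spectral.

Section Gossip.
Context (R : realType).

(** Sylvester's determinant identity for a rank-one matrix: multiply the block
    matrix [1, w; c, X] by block triangular matrices on either side. *)
Lemma det_rank1 (A : comNzRingType) n (x : A) (c : 'cV[A]_n) (w : 'rV[A]_n) :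
  x * \det (x%:M - c *m w) = x ^+ n * (x - (w *m c) 0 0).
Proof.
pose E := block_mx (1%:M : 'M[A]_1) w c (x%:M).
have -> : \det (x%:M - c *m w) = \det E.
  have -> : E = block_mx 1%:M 0 c 1%:M *m block_mx 1%:M w 0 (x%:M - c *m w).
    rewrite mulmx_block !mul1mx !mul0mx !mulmx1 !addr0.
    by rewrite addrC subrK.
  by rewrite det_mulmx det_lblock det_ublock !det1 !mul1r.
have e : E *m block_mx (x%:M : 'M[A]_1) 0 (- c) 1%:M =
    block_mx (x%:M - w *m c) w 0 x%:M.
  rewrite mulmx_block !mul1mx !mulmx1 !mulmx0 !add0r mulmxN.
  by rewrite mul_mx_scalar mul_scalar_mx scalerN subrr.
have := congr1 determinant e.
rewrite det_mulmx det_lblock det_ublock det1 mulr1 det_scalar1 det_scalar.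
by rewrite det_mx11 !mxE eqxx mulr1n mulrC (mulrC (x ^+ n)) => ->.
Qed.

(** Deflation: removing the eigenvalue 1 carried by the constant vector. *)
Lemma char_poly_deflate n (A : 'M[R]_n) (c : 'cV[R]_n) (w : 'rV[R]_n) :
  A *m c = c -> w *m A = w -> w *m c = 1%:M ->
  'X * char_poly A = char_poly (A - c *m w) * ('X - 1%:P).
Proof.
move=> Ac wA wc; have X0 : ('X : {poly R}) != 0 by rewrite polyX_eq0.
pose pc := map_mx polyC c; pose pw := map_mx polyC w.
have pwc : pw *m pc = 1%:M by rewrite -map_mxM wc map_mx1.
have e : 'X *: char_poly_mx A =
    char_poly_mx (A - c *m w) *m ('X%:M - pc *m pw).
  rewrite /char_poly_mx map_mxB map_mxM -/pc -/pw.
  have AJ : map_mx polyC A *m (pc *m pw) = pc *m pw.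
    by rewrite mulmxA -map_mxM Ac.
  have JJ : pc *m pw *m (pc *m pw) = pc *m pw.
    by rewrite mulmxA -[pc *m pw *m pc]mulmxA pwc mulmx1.
  have h : ('X%:M - (map_mx polyC A - pc *m pw)) *m (pc *m pw) =
      'X *: (pc *m pw).
    by rewrite !mulmxBl AJ JJ subrr subr0 mul_scalar_mx.
  rewrite mulmxBr mul_mx_scalar h -scalerBr opprB addrA addrAC.
  by rewrite addrK.
have := congr1 determinant e; rewrite detZ det_mulmx => /(congr1 (fun z => 'X * z)).
rewrite [RHS]mulrCA det_rank1 pwc mxE eqxx mulr1n => h.
have : 'X ^+ n * ('X * char_poly A) =
  'X ^+ n * (char_poly (A - c *m w) * ('X - 1%:P)).
  by rewrite mulrCA -/(char_poly A) in h *; rewrite h mulrCA.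
by apply: mulfI; rewrite expf_neq0.
Qed.

(** The singular value 1 of the constant vector must head the sorted list, since
    the second one is smaller than 1. Deflation trades it for 0, so the squared
    eigenvalues of the deflated matrix are 0 or come from the tail of the list. *)
Lemma gossip_eigenvalue n (P : 'M[R]_n) (rho : R) : (0 < n)%N ->
  P^T = P -> (forall i, \sum_j P i j = 1) ->
  second_singular_value P rho -> rho < 1 ->
  forall a, eigenvalue (P - const_mx n%:R^-1) a -> a ^+ 2 <= rho ^+ 2.
Proof.
move=> n0 Psym Prow [s [ssort spos sE] rhoE] rho1 a /eigenvalueP[v va v0].
pose c : 'cV[R]_n := const_mx 1; pose w : 'rV[R]_n := const_mx n%:R^-1.
have n0R : n%:R != 0 :> R by rewrite pnatr_eq0 -lt0n.
have JE : const_mx n%:R^-1 = c *m w.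
  by apply/matrixP => i j; rewrite !mxE big_ord1 !mxE mul1r.
have Pc : P *m c = c.
  apply/colP => i; rewrite !mxE -[RHS](Prow i).
  by apply: eq_bigr => j _; rewrite mxE mulr1.
have wP : w *m P = w.
  have wE : w = n%:R^-1 *: c^T by apply/rowP => j; rewrite !mxE mulr1.
  by rewrite wE -scalemxAl -{1}Psym -trmx_mul Pc.
have wc : w *m c = 1%:M.
  apply/matrixP => i j; rewrite !mxE !ord1 eqxx mulr1n.
  under eq_bigr do rewrite !mxE mulr1.
  by rewrite sumr_const card_ord -[_ *+ n]mulr_natr mulVf.
pose A := P^T *m P; have AE : A = P *m P by rewrite /A Psym.
have Ac : A *m c = c by rewrite AE -mulmxA !Pc.
have wA : w *m A = w by rewrite AE mulmxA !wP.
have := char_poly_deflate Ac wA wc; rewrite sE.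
have vA : v *m (A - c *m w) = a ^+ 2 *: v.
  have e : A - c *m w = (P - c *m w) *m (P - c *m w).
    have JP : c *m w *m P = c *m w by rewrite -mulmxA wP.
    have PJ : P *m (c *m w) = c *m w by rewrite mulmxA Pc.
    have JJ : c *m w *m (c *m w) = c *m w.
      by rewrite mulmxA -[c *m w *m c]mulmxA wc mulmx1.
    by rewrite mulmxBl !mulmxBr JP PJ JJ subrr subr0 AE.
  by rewrite e mulmxA -JE va -scalemxAl va scalerA.
have ra : root (char_poly (A - c *m w)) (a ^+ 2).
  by rewrite -eigenvalue_root_char; apply/eigenvalueP; exists v.
have /hasP[b bs /eqP b1] : has (fun b => b ^+ 2 == 1) s.
  have : root (char_poly A) 1.
    rewrite -eigenvalue_root_char; apply/eigenvalueP; exists w.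
      by rewrite wA scale1r.
    apply/eqP => /rowP /(_ (Ordinal n0)) /eqP.
    by rewrite !mxE invr_eq0 (negPf n0R).
  rewrite sE /root horner_prod prodf_seq_eq0 => /hasP[b bs].
  by rewrite !hornerE subr_eq0 eq_sym => h; apply/hasP; exists b.
have {b1} b1 : b = 1.
  have b0 : 0 <= b by exact: (allP spos).
  by apply/eqP; rewrite -(@eqrXn2 _ 2) // b1 expr1n.
case: s => [//|s0 s] in ssort spos sE rhoE bs *.
have sle x : x \in s -> x <= rho.
  rewrite rhoE; case: s ssort {sE bs spos rhoE} => [//|s1 s] /= /andP[_ h].
  rewrite inE => /orP[/eqP -> //|xs].
  have tr : transitive (fun x y : R => y <= x).
    by move=> ? ? ? h1 h2; exact: le_trans h2 h1.
  exact: (allP (order_path_min tr h)).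
have s01 : s0 = 1.
  move: bs; rewrite inE b1 => /orP[/eqP //|/sle].
  by rewrite leNgt rho1.
rewrite big_cons s01 expr1n mulrCA [RHS]mulrC => /mulfI.
rewrite polyXsubC_eq0 => /(_ isT) e; move: ra; rewrite -e rootM.
rewrite rootX => /orP[/eqP ->|]; first exact: sqr_ge0.
rewrite /root horner_prod prodf_seq_eq0 => /hasP[x xs].
rewrite !hornerE subr_eq0 => /eqP ->.
have x0 : 0 <= x by apply: (allP spos); rewrite inE xs orbT.
have xr := sle _ xs.
by rewrite ler_pXn2r ?nnegrE //; exact: le_trans xr.
Qed.

Definition avg n d (Y : 'I_n -> 'rV[R]_d) : 'rV[R]_d :=
  n%:R^-1 *: \sum_i Y i.

Definition mix n d (P : 'M[R]_n) (Y : 'I_n -> 'rV[R]_d) (i : 'I_n) :=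
  \sum_j P i j *: Y j.

Definition spread n d (Y : 'I_n -> 'rV[R]_d) : R :=
  \sum_i dotp (Y i - avg Y) (Y i - avg Y).

Lemma avg_sum n d (Y : 'I_n -> 'rV[R]_d) : (0 < n)%N ->
  \sum_i (Y i - avg Y) = 0.
Proof.
move=> n0; rewrite sumrB sumr_const card_ord /avg -scaler_nat scalerA.
by rewrite mulfV ?scale1r ?subrr // pnatr_eq0 -lt0n.
Qed.

Lemma avgD n d (Y Z : 'I_n -> 'rV[R]_d) :
  avg (fun i => Y i + Z i) = avg Y + avg Z.
Proof. by rewrite /avg big_split scalerDr. Qed.

Lemma avg_mix n d (P : 'M[R]_n) (Y : 'I_n -> 'rV[R]_d) :
  (forall j, \sum_i P i j = 1) -> avg (mix P Y) = avg Y.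
Proof.
move=> Pcol; congr (_ *: _); rewrite exchange_big /=; apply: eq_bigr => j _.
by rewrite -scaler_suml Pcol scale1r.
Qed.

(** Deviations from the average sum to zero, and on such families [P] acts as its
    deflation. *)
Lemma spread_mix n d (P : 'M[R]_n) (rho : R) (Y : 'I_n -> 'rV[R]_d) :
  (0 < n)%N -> P^T = P -> doubly_stochastic P ->
  second_singular_value P rho -> rho < 1 ->
  spread (mix P Y) <= rho ^+ 2 * spread Y.
Proof.
move=> n0 Psym [_ Prow Pcol] Ps rho1.
pose V := fun i => Y i - avg Y; pose M := P - const_mx n%:R^-1.
have Msym : M^T = M.
  by rewrite /M linearB /= Psym; congr (_ - _); apply/matrixP => i j; rewrite !mxE.
have mixE i l : (mix P Y i - avg (mix P Y)) 0 l = ((\row_k V k 0 l) *m M) 0 i.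
  have -> : mix P Y i - avg (mix P Y) = \sum_k P i k *: V k.
    rewrite avg_mix // /V; under [RHS]eq_bigr do rewrite scalerBr.
    by rewrite sumrB -scaler_suml Prow scale1r.
  rewrite summxE mxE.
  have V0 : \sum_k V k 0 l = 0 by rewrite -summxE avg_sum // mxE.
  transitivity (\sum_k V k 0 l * (P k i - n%:R^-1)); last first.
    by apply: eq_bigr => k _; rewrite !mxE.
  under [RHS]eq_bigr do rewrite mulrBr.
  rewrite sumrB -mulr_suml V0 mul0r subr0; apply: eq_bigr => k _.
  by rewrite [LHS]mxE mulrC; congr (_ * _); rewrite -[in LHS]Psym mxE.
rewrite /spread /dotp exchange_big [X in _ * X]exchange_big mulr_sumr /=.
apply: ler_sum => l _.
have := sym_opnorm Msym (gossip_eigenvalue n0 Psym Prow Ps rho1)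
  (\row_k V k 0 l).
congr (_ <= _ * _).
  by apply: eq_bigr => i _; rewrite !mixE.
by apply: eq_bigr => i _; rewrite !mxE.
Qed.

Lemma spread_var n d (Y : 'I_n -> 'rV[R]_d) u : (0 < n)%N ->
  \sum_i dotp (Y i - u) (Y i - u) =
  spread Y + n%:R * dotp (avg Y - u) (avg Y - u).
Proof.
move=> n0; rewrite /spread; set a := avg Y.
have e i : dotp (Y i - u) (Y i - u) = dotp (Y i - a) (Y i - a) +
    (2 * dotp (Y i - a) (a - u) + dotp (a - u) (a - u)).
  have -> : Y i - u = (Y i - a) + (a - u) by rewrite addrA subrK.
  by move: (Y i - a) (a - u) => x y; rewrite !dotpE (dotpC y x); ring.
under eq_bigr do rewrite e.
rewrite big_split /= big_split /= -mulr_sumr -dotp_suml avg_sum // dotp0l.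
by rewrite mulr0 add0r sumr_const card_ord mulr_natl.
Qed.

Lemma spread_ge0 n d (Y : 'I_n -> 'rV[R]_d) : 0 <= spread Y.
Proof. by apply: sumr_ge0 => i _; exact: dotp_ge0. Qed.

Lemma spread_le n d (Y : 'I_n -> 'rV[R]_d) u : (0 < n)%N ->
  spread Y <= \sum_i dotp (Y i - u) (Y i - u).
Proof.
by move=> n0; rewrite spread_var // lerDl mulr_ge0 // ?ler0n ?dotp_ge0.
Qed.

Lemma enorm_avg n d (Y : 'I_n -> 'rV[R]_d) (D : R) : (0 < n)%N ->
  (forall i, enorm (Y i) <= D) -> enorm (avg Y) <= D.
Proof.
move=> n0 YD; rewrite /avg enormZ ger0_norm ?invr_ge0 //.
rewrite ler_pdivrMl ?ltr0n //; apply: le_trans (enorm_sum _ _ _) _.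
apply: le_trans (ler_sum _ (fun i _ => YD i)) _.
by rewrite sumr_const card_ord mulr_natl.
Qed.

End Gossip.

(** * Smooth functions and Goldstein subgradients *)

Section Calculus.
Context (R : realType) (d : nat).
Implicit Types (f : 'rV[R]_d -> R) (x y v : 'rV[R]_d).

Lemma derive_grad f x v : differentiable f x -> 'D_v f x = dotp (grad f x) v.
Proof.
move=> df; rewrite deriveE // {1}(row_sum_delta v) linear_sum.
apply: eq_bigr => j _; rewrite linearZ /= mxE deriveE //.
by rewrite [LHS]mulrC.
Qed.

Lemma line_is_derive f y v (t : R) : (forall x, differentiable f x) ->
  is_derive t 1 (fun t : R => f (y + t *: v)) (dotp (grad f (y + t *: v)) v).
Proof.
move=> df; have dv : derivable f (y + t *: v) v by exact: diff_derivable.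
have e : (fun h : R => h^-1 *:
      (((fun t : R => f (y + t *: v)) \o shift t) (h *: (1 : R))
        - f (y + t *: v))) =
    (fun h : R => h^-1 *: ((f \o shift (y + t *: v)) (h *: v) - f (y + t *: v))).
  apply/funext => h /=; congr (_ *: (f _ - _)).
  by rewrite [h *: 1]mulr1 scalerDl addrA addrAC addrC addrA addrAC.
split; first by rewrite /derivable e.
by rewrite /derive e -derive_grad.
Qed.

(** First-order expansion by the mean value theorem; the constant is not the
    optimal [L1 / 2]. *)
Lemma smooth_descent (L1 : R) f y v : 0 <= L1 -> smooth L1 f ->
  f (y + v) - f y <= dotp (grad f y) v + L1 * dotp v v.
Proof.
move=> L0 [df gl]; pose phi (t : R) := f (y + t *: v).
have dphi (t : R) : is_derive t 1 phi (dotp (grad f (y + t *: v)) v).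
  exact: line_is_derive.
have [c|c] := @MVT_segment R phi (fun t => dotp (grad f (y + t *: v)) v) 0 1
  ler01 (fun t _ => dphi t).
  apply: continuous_subspaceT => t; apply: differentiable_continuous.
  by apply/derivable1_diffP; have [] := dphi t.
rewrite in_itv /= => /andP[c0 c1].
rewrite /phi scale1r scale0r addr0 subr0 mulr1 => ->.
have -> : dotp (grad f (y + c *: v)) v =
  dotp (grad f y) v + dotp (grad f (y + c *: v) - grad f y) v.
  by rewrite dotpBl addrCA subrr addr0.
rewrite lerD2l; apply: le_trans (dotp_CS _ _) _.
apply: le_trans (ler_wpM2r (enorm_ge0 _) (gl _ _)) _.
rewrite addrC addKr enormZ ger0_norm // -enorm_sqr -mulrA.
rewrite ler_wpM2l // expr2 -mulrA ler_piMl // mulr_ge0 ?enorm_ge0 //.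
Qed.

Lemma grad_mean n (h : 'I_n -> 'rV[R]_d -> R) x :
  (forall i x, differentiable (h i) x) ->
  differentiable (fun x => n%:R^-1 * \sum_i h i x) x /\
  grad (fun x => n%:R^-1 * \sum_i h i x) x = avg (fun i => grad (h i) x).
Proof.
move=> dh.
have -> : (fun x => n%:R^-1 * \sum_i h i x) = n%:R^-1 *: (\sum_i h i).
  by apply/funext => y; rewrite /GRing.scale /= fct_sumE.
have ds : differentiable (\sum_i h i) x by apply: differentiable_sum.
split; first exact: differentiableZ.
apply/rowP => j; rewrite !mxE summxE deriveZ; last exact: diff_derivable.
rewrite derive_sum; last by move=> i; exact: diff_derivable.
by congr (_ * _); apply: eq_bigr => i _; rewrite mxE.
Qed.

Lemma smooth_mean n (L1 : R) (h : 'I_n -> 'rV[R]_d -> R) : (0 < n)%N ->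
  (forall i, smooth L1 (h i)) -> smooth L1 (fun x => n%:R^-1 * \sum_i h i x).
Proof.
move=> n0 sh; have dh i y : differentiable (h i) y by have [] := sh i.
split=> [x|x y]; first by have [] := grad_mean x dh.
have [_ ->] := grad_mean x dh; have [_ ->] := grad_mean y dh.
rewrite /avg -scalerBr -sumrB; apply: enorm_avg => // i.
by have [_] := sh i.
Qed.

End Calculus.

Section Goldstein.
Context (R : realType) (d : nat).

(** An average of gradients taken inside the ball is a Goldstein subgradient,
    each gradient being its own limit along a constant sequence. *)
Lemma goldstein_norm_avg T (f : 'rV[R]_d -> R) (delta : R) x
    (y : 'I_T -> 'rV[R]_d) : (0 < T)%N -> (forall x, differentiable f x) ->
  (forall t, enorm (y t - x) <= delta) ->
  0 <= goldstein_norm f delta x <= enorm (avg (fun t => grad f (y t))).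
Proof.
move=> T0 df yb.
have clarke_grad z : clarke f z (grad f z).
  exists 1%N, (fun=> 1), (fun=> grad f z); split=> //.
  - by rewrite big_ord1.
  - move=> _; exists (fun=> z); split=> //; exact: cvg_cst.
  - by rewrite big_ord1 scale1r.
have gin : goldstein f delta x (avg (fun t => grad f (y t))).
  exists T, (fun=> T%:R^-1), (fun t => grad f (y t)); split.
  - by move=> _; rewrite invr_ge0.
  - by rewrite sumr_const card_ord -[_ *+ T]mulr_natr mulVf // pnatr_eq0 -lt0n.
  - by move=> t; exists (y t); [exact: yb|exact: clarke_grad].
  - by rewrite /avg scaler_sumr.
apply/andP; split.
  apply: lb_le_inf; first by eexists; exists (avg (fun t => grad f (y t))).
  by move=> _ [g _ <-]; exact: enorm_ge0.
apply: ge_inf; last by exists (avg (fun t => grad f (y t))).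
by exists 0 => _ [g _ <-]; exact: enorm_ge0.
Qed.

End Goldstein.

(** * One epoch along a fixed trajectory *)

Section Pathwise.
Context (R : realType) (n d : nat) (P : 'M[R]_n) (rho D eta : R).
Hypotheses (n_gt0 : (0 < n)%N) (D_gt0 : 0 < D) (eta_gt0 : 0 < eta).
Hypotheses (P_sym : P^T = P) (P_ds : doubly_stochastic P).
Hypotheses (P_rho : second_singular_value P rho) (rho01 : 0 <= rho < 1).

(** The minimiser of the online update in closed form, see [argmin_proj]. *)
Definition action (S : state R n d) (i : 'I_n) : 'rV[R]_d :=
  proj D (st_Dhalf S i - eta *: st_g S i).

(** What the pathwise analysis retains of the algorithm: the gossip updates, and
    query points within one action of the iterates. The gradients [st_g] are
    arbitrary, so every realisation of the draws is covered. *)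
Definition trajectory (S : nat -> state R n d) : Prop :=
  forall t i,
  [/\ st_y (S t.+1) i = mix P (fun j => st_y (S t) j + action (S t) j) i,
      st_Dhalf (S t.+1) i = mix P (action (S t)) i &
      enorm (st_w (S t.+1) i - st_y (S t) i) <= D].

Definition ybar (S : state R n d) : 'rV[R]_d := avg (st_y S).
Definition abar (S : state R n d) : 'rV[R]_d := avg (action S).

Variable S : nat -> state R n d.
Hypothesis S_traj : trajectory S.

Let nR_gt0 : 0 < n%:R :> R. Proof. by rewrite ltr0n. Qed.
Let rho_ge0 : 0 <= rho. Proof. by case/andP: rho01. Qed.
Let rho_lt1 : rho < 1. Proof. by case/andP: rho01. Qed.
Let q_gt0 : 0 < 1 - rho. Proof. by rewrite subr_gt0. Qed.

Let P_col j : \sum_i P i j = 1. Proof. by have [_ _] := P_ds. Qed.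

Lemma action_in (T : state R n d) i : enorm (action T i) <= D.
Proof. exact: proj_in. Qed.

Lemma abar_in (T : state R n d) : enorm (abar T) <= D.
Proof. by apply: enorm_avg => // i; exact: action_in. Qed.

Lemma st_yE t : st_y (S t.+1) = mix P (fun j => st_y (S t) j + action (S t) j).
Proof. by apply/funext => i; have [] := S_traj t i. Qed.

Lemma st_DhalfE t : st_Dhalf (S t.+1) = mix P (action (S t)).
Proof. by apply/funext => i; have [] := S_traj t i. Qed.

Lemma ybarS t : ybar (S t.+1) = ybar (S t) + abar (S t).
Proof. by rewrite /ybar st_yE avg_mix // avgD. Qed.

(** The distance from the average that no query point exceeds, see [w_near_ybar]. *)
Definition tube : R := Num.sqrt n%:R * D / (1 - rho).

Lemma spread_action t : spread (action (S t)) <= n%:R * D ^+ 2.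
Proof.
apply: le_trans (spread_le _ 0 n_gt0) _.
have h (i : 'I_n) : true ->
    dotp (action (S t) i - 0) (action (S t) i - 0) <= D ^+ 2.
  by move=> _; rewrite subr0; exact/dotp_le_sqr/action_in.
by apply: le_trans (ler_sum _ h) _; rewrite sumr_const card_ord mulr_natl.
Qed.

(** [(rho * tube)^2] is the fixed point of the recursion satisfied by the
    disagreement. *)
Lemma spread_y t : spread (st_y (S 0)) <= (rho * tube) ^+ 2 ->
  spread (st_y (S t)) <= (rho * tube) ^+ 2.
Proof.
move=> h0; elim: t => [//|t IH]; rewrite st_yE.
apply: le_trans (spread_mix _ n_gt0 P_sym P_ds P_rho rho_lt1) _.
have [r0|r0] := eqVneq rho 0; first by rewrite r0 !expr0n /= !mul0r expr0n.
have rpos : 0 < rho by rewrite lt_def r0.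
have h : spread (fun j => st_y (S t) j + action (S t) j) <=
    rho^-1 * spread (st_y (S t)) + (1 - rho)^-1 * spread (action (S t)).
  rewrite /spread !mulr_sumr -big_split /=; apply: ler_sum => i _.
  by rewrite avgD opprD addrACA; apply: dotp_convex; rewrite rpos.
apply: le_trans (ler_wpM2l (sqr_ge0 _) h) _.
have tE : tube ^+ 2 = n%:R * D ^+ 2 / (1 - rho) ^+ 2.
  by rewrite /tube !exprMn sqr_sqrtr ?ler0n // exprVn.
apply: (@le_trans _ _ (rho ^+ 2 * (rho^-1 * (rho * tube) ^+ 2 +
   (1 - rho)^-1 * (n%:R * D ^+ 2)))).
  rewrite ler_wpM2l ?sqr_ge0 // lerD //.
    by rewrite ler_wpM2l // invr_ge0.
  by rewrite ler_wpM2l ?spread_action // invr_ge0 ltW.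
rewrite exprMn tE le_eqVlt; apply/orP; left; apply/eqP; field.
by rewrite r0 (lt0r_neq0 q_gt0).
Qed.

Lemma w_near_ybar t i : spread (st_y (S 0)) <= (rho * tube) ^+ 2 ->
  enorm (st_w (S t.+1) i - ybar (S t)) <= tube.
Proof.
move=> h0; have [_ _ wy] := S_traj t i.
have tube_ge0 : 0 <= tube by rewrite !mulr_ge0 ?sqrtr_ge0 ?invr_ge0 ?ltW.
have hy : enorm (st_y (S t) i - ybar (S t)) <= rho * tube.
  apply: enorm_le; first by rewrite mulr_ge0.
  apply: le_trans (spread_y t h0); rewrite /spread (bigD1 i) //= lerDl.
  by apply: sumr_ge0 => j _; exact: dotp_ge0.
apply: le_trans (enorm_dist _ (st_y (S t) i) _) _.
apply: le_trans (lerD wy hy) _.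
have s1 : 1 <= Num.sqrt n%:R :> R by rewrite -[X in X <= _]sqrtr1 ler_sqrt // ler1n.
have {2}-> : tube = Num.sqrt n%:R * D + rho * tube.
  by rewrite /tube; field; rewrite (lt0r_neq0 q_gt0).
by rewrite lerD2r ler_peMl // ltW.
Qed.

(** Lyapunov function of the online learner: the distance to the comparator
    and the disagreement between the agents. *)
Definition potential (u : 'rV[R]_d) (T : state R n d) : R :=
  \sum_i dotp (action T i - u) (action T i - u) + spread (action T).

Lemma regret_step u t : enorm u <= D ->
  \sum_i dotp (st_g (S t.+1) i) (abar (S t) - u) <=
  (2 * eta)^-1 * (potential u (S t) - potential u (S t.+1)) +
  5 / 2 * (eta / (1 - rho)) * \sum_i dotp (st_g (S t.+1) i) (st_g (S t.+1) i).
Proof.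
move=> uD; set a := action (S t); set g := st_g (S t.+1).
pose h := mix P a; pose a' := action (S t.+1); pose ab := abar (S t).
have a'E i : a' i = proj D (h i - eta *: g i).
  by rewrite /a' /action st_DhalfE.
set Gam := \sum_i dotp (g i) (g i).
have Gam0 : 0 <= Gam by apply: sumr_ge0 => i _; exact: dotp_ge0.
have habar : avg h = ab by rewrite /h avg_mix.
have rho2 : rho ^+ 2 <= 1 by rewrite expr_le1 // ltW.
have hC : spread h <= rho ^+ 2 * spread a by exact: spread_mix.
have C0 : 0 <= spread a by exact: spread_ge0.
have hC1 : spread h <= spread a by apply: le_trans hC _; rewrite ler_piMl.
pose Phi (b : 'I_n -> 'rV[R]_d) := \sum_i dotp (b i - u) (b i - u).
have hPhi : Phi h <= Phi a.
  by rewrite /Phi !spread_var // habar lerD2r.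
have hA : Phi a' <= Phi h - 2 * eta * \sum_i dotp (g i) (h i - u) + eta ^+ 2 * Gam.
  rewrite /Phi /Gam !mulr_sumr -sumrB -big_split /=; apply: ler_sum => i _.
  rewrite a'E; apply: le_trans (proj_nonexpansive _ D_gt0 uD) _.
  rewrite addrAC; move: (h i - u) (g i) => x y.
  by rewrite !dotpE (dotpC y x) le_eqVlt; apply/orP; left; apply/eqP; ring.
have hD : spread a' <= (1 + rho) / 2 * spread a + 2 * eta ^+ 2 / (1 - rho) * Gam.
  apply: le_trans (spread_le _ ab n_gt0) _.
  pose r := (1 + rho) / 2; have r01 : 0 < r < 1 
    by move: rho_ge0 rho_lt1 => ? ?; rewrite /r; apply/andP; split; lra.
  have h1 : \sum_i dotp (a' i - ab) (a' i - ab) <=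
      r^-1 * spread h + 2 * eta ^+ 2 / (1 - rho) * Gam.
    rewrite /spread /Gam !mulr_sumr -big_split /=; apply: ler_sum => i _.
    rewrite a'E; apply: le_trans (proj_nonexpansive _ D_gt0 (abar_in _)) _.
    rewrite addrAC habar; apply: le_trans (dotp_convex _ _ r01) _.
    rewrite lerD2l dotpNl dotpNr opprK dotpZl dotpZr.
    rewrite le_eqVlt; apply/orP; left; apply/eqP; rewrite /r; field.
    by rewrite lt0r_neq0.
  apply: le_trans h1 _; rewrite lerD2r.
  have /andP[r0 r1] := r01; rewrite ler_pdivrMl //.
  apply: le_trans hC _; rewrite mulrA ler_wpM2r //.
  have rr : rho <= r by move: rho_lt1 => ?; rewrite /r; lra.
  by rewrite -expr2 ler_pXn2r ?nnegrE // (le_trans _ rr).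
have hE : \sum_i dotp (g i) (ab - h i) <=
    eta / (1 - rho) * Gam + (1 - rho) / (4 * eta) * spread a.
  have ap : 0 < 2 * eta / (1 - rho) by rewrite divr_gt0 // mulr_gt0.
  apply: (@le_trans _ _ (eta / (1 - rho) * Gam + (1 - rho) / (4 * eta) * spread h)).
    rewrite /Gam /spread !mulr_sumr -big_split /=; apply: ler_sum => i _.
    apply: le_trans (dotp_young _ _ ap) _; rewrite habar.
    rewrite -[ab - h i]opprB dotpNl dotpNr opprK.
    rewrite le_eqVlt; apply/orP; left; apply/eqP; field.
    by rewrite (lt0r_neq0 eta_gt0) (lt0r_neq0 q_gt0).
  by rewrite lerD2l ler_wpM2l // divr_ge0 ?ltW // mulr_gt0.
have -> : \sum_i dotp (g i) (ab - u) =
    \sum_i dotp (g i) (h i - u) + \sum_i dotp (g i) (ab - h i).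
  by rewrite -big_split; apply: eq_bigr => i _ /=; rewrite -dotpDr [in RHS]addrC subrKA.
rewrite /potential -/a -/a' -/(Phi a) -/(Phi a').
have e1 : \sum_i dotp (g i) (h i - u) <=
    (2 * eta)^-1 * (Phi a - Phi a') + eta / (1 - rho) / 2 * Gam.
  have : eta * Gam <= eta / (1 - rho) * Gam.
    by rewrite ler_wpM2r // ler_pdivlMr // ler_piMr ?gerBl // ltW.
  have : (2 * eta)^-1 * (2 * eta * \sum_i dotp (g i) (h i - u)) <=
     (2 * eta)^-1 * (Phi a - Phi a' + eta ^+ 2 * Gam).
    apply: ler_wpM2l; first by rewrite invr_ge0 mulr_ge0 // ltW.
    by move: hA hPhi; lra.
  rewrite mulKf ?mulf_neq0 ?lt0r_neq0 // mulrDr.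
  have -> : (2 * eta)^-1 * (eta ^+ 2 * Gam) = eta * Gam / 2.
    by field; rewrite lt0r_neq0.
  by lra.
have e2 : (1 - rho) / (4 * eta) * spread a <=
    (2 * eta)^-1 * (spread a - spread a') + eta / (1 - rho) * Gam.
  have -> : (1 - rho) / (4 * eta) * spread a =
     (2 * eta)^-1 * ((1 - rho) / 2 * spread a).
    by field; rewrite lt0r_neq0.
  have -> : eta / (1 - rho) * Gam =
     (2 * eta)^-1 * (2 * eta ^+ 2 / (1 - rho) * Gam).
    by field; rewrite !lt0r_neq0.
  rewrite -mulrDr; apply: ler_wpM2l; first by rewrite invr_ge0 mulr_ge0 // ltW.
  by move: hD; lra.
by move: e1 e2 hE; rewrite !mulrBr !mulrDr; lra.
Qed.

Variables (h : 'I_n -> 'rV[R]_d -> R) (L1 : R).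
Hypotheses (L1_ge0 : 0 <= L1) (h_smooth : forall i, smooth L1 (h i)).
Hypothesis y0_spread : spread (st_y (S 0)) <= (rho * tube) ^+ 2.

Let f (x : 'rV[R]_d) : R := n%:R^-1 * \sum_i h i x.

Definition noise (T : state R n d) (i : 'I_n) : 'rV[R]_d :=
  grad (h i) (st_w T i) - st_g T i.

Lemma dotp_avg (V : 'I_n -> 'rV[R]_d) x :
  dotp (avg V) x = n%:R^-1 * \sum_i dotp (V i) x.
Proof. by rewrite dotpZl dotp_suml. Qed.

Lemma grad_f x : grad f x = avg (fun i => grad (h i) x).
Proof. by have [] := @grad_mean R d n h x (fun i => proj1 (h_smooth i)). Qed.

(** One round: the descent of [f] along the averaged action, with the exact
    gradient at the average replaced by the stochastic gradients that the
    agents see, fed into the regret bound. *)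
Lemma descent_step u t : enorm u <= D ->
  - dotp (grad f (ybar (S t))) u <=
  f (ybar (S t)) - f (ybar (S t.+1)) + (L1 * D ^+ 2 + 2 * L1 * tube * D) +
  n%:R^-1 * (\sum_i dotp (noise (S t.+1) i) (abar (S t))
    - \sum_i dotp (noise (S t.+1) i) u
    + ((2 * eta)^-1 * (potential u (S t) - potential u (S t.+1)) +
       5 / 2 * (eta / (1 - rho)) *
         \sum_i dotp (st_g (S t.+1) i) (st_g (S t.+1) i))).
Proof.
move=> uD; have tube_ge0 : 0 <= tube by rewrite !mulr_ge0 ?sqrtr_ge0 ?invr_ge0 ?ltW.
set y := ybar (S t); set a := abar (S t); set g := st_g (S t.+1).
set w := st_w (S t.+1); set m := noise (S t.+1).
have hf : f (ybar (S t.+1)) - f y <= dotp (grad f y) a + L1 * D ^+ 2.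
  rewrite ybarS; apply: le_trans (smooth_descent _ _ L1_ge0 _) _.
    exact: smooth_mean.
  by rewrite lerD2l ler_wpM2l // dotp_le_sqr // abar_in.
have hg : dotp (grad f y) (a - u) <= 2 * L1 * tube * D +
    n%:R^-1 * (\sum_i dotp (m i) a - \sum_i dotp (m i) u +
               \sum_i dotp (g i) (a - u)).
  rewrite grad_f dotp_avg.
  have -> : 2 * L1 * tube * D = n%:R^-1 * \sum_(i < n) (2 * L1 * tube * D).
    by rewrite sumr_const card_ord -[X in _ = _ * X]mulr_natl mulKf ?lt0r_neq0.
  rewrite -mulrDr ler_wpM2l ?invr_ge0 // -sumrB -!big_split /=.
  apply: ler_sum => i _.
  have -> : dotp (grad (h i) y) (a - u) =
     dotp (grad (h i) y - grad (h i) (w i)) (a - u) +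
     (dotp (m i) a - dotp (m i) u + dotp (g i) (a - u)).
    rewrite -dotpBr -!dotpDl; congr dotp; rewrite /m /noise -/g -/w.
    by rewrite subrK subrK.
  rewrite lerD2r; apply: le_trans (dotp_CS _ _) _.
  have h1 : enorm (grad (h i) y - grad (h i) (w i)) <= L1 * tube.
    have [_ gl] := h_smooth i; apply: le_trans (gl _ _) _.
    by rewrite ler_wpM2l // enormC w_near_ybar.
  have h2 : enorm (a - u) <= 2 * D.
    apply: le_trans (enormD _ _) _; rewrite enormN mulr2n mulrDl mul1r.
    by rewrite lerD // abar_in.
  have -> : 2 * L1 * tube * D = (L1 * tube) * (2 * D) by ring.
  by apply: ler_pM; rewrite ?enorm_ge0.
have hr := regret_step t uD; rewrite -/a -/g in hr.
have hr' : n%:R^-1 * \sum_i dotp (g i) (a - u) <= n%:R^-1 *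
  ((2 * eta)^-1 * (potential u (S t) - potential u (S t.+1)) +
       5 / 2 * (eta / (1 - rho)) * \sum_i dotp (g i) (g i)).
  by rewrite ler_wpM2l // invr_ge0.
have e : - dotp (grad f y) u = dotp (grad f y) (a - u) - dotp (grad f y) a.
  by rewrite dotpBr; ring.
by move: hf hg hr'; rewrite e !mulrDr; lra.
Qed.

Definition noise_sum t i : 'rV[R]_d := \sum_(k < t) noise (S k.+1) i.

(** The random part that agent [i] contributes to the epoch bound in round [t].
    The scale [b] trades the norm of the accumulated noise for its square, by
    x <= x^2 / (2 b) + b / 2. *)
Definition increment (b : R) t i : R :=
  dotp (noise (S t.+1) i) (abar (S t) + (D / b) *: noise_sum t i)
  + D / (2 * b) * dotp (noise (S t.+1) i) (noise (S t.+1) i)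
  + 5 / 2 * (eta / (1 - rho)) * dotp (st_g (S t.+1) i) (st_g (S t.+1) i).

(** Expanding the square of a sum of increments: the cross terms pair each
    increment with the past, which is what makes them vanish on average. *)
Lemma noise_sum_sqr t i : dotp (noise_sum t i) (noise_sum t i) =
  \sum_(k < t) (dotp (noise (S k.+1) i) (noise (S k.+1) i)
                + 2 * dotp (noise (S k.+1) i) (noise_sum k i)).
Proof.
elim: t => [|t IH]; first by rewrite /noise_sum !big_ord0 dotp0l.
rewrite [RHS]big_ord_recr /= -IH /noise_sum big_ord_recr /=.
move: (\sum_(k < t) _) (noise _ i) => x y.
by rewrite !dotpE (dotpC y x); ring.
Qed.

(** The gradients of one epoch cannot add up to a long vector unless [f] decreases:
    the learner competes with the action pointing against their sum. *)
Lemma epoch_bound T (b : R) : 0 < b ->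
  (forall i, st_Dhalf (S 0) i = 0) -> (forall i, st_g (S 0) i = 0) ->
  D * enorm (\sum_(t < T) grad f (ybar (S t))) <=
  f (ybar (S 0)) - f (ybar (S T)) +
  (T%:R * (L1 * D ^+ 2 + 2 * L1 * tube * D) + D * b / 2 + D ^+ 2 / (2 * eta))
  + n%:R^-1 * \sum_(t < T) \sum_i increment b t i.
Proof.
move=> b0 Dh0 g0; set v := \sum_(t < T) grad _ _.
(* The best fixed action in hindsight; when v = 0 the quotient is 0. *)
pose u := - (D / enorm v) *: v.
have v0 := enorm_ge0 v.
have vu : - dotp v u = D * enorm v.
  rewrite /u dotpZr -enorm_sqr; have [->|vn] := eqVneq (enorm v) 0.
    by rewrite expr0n /= !mulr0 oppr0.
  by field.
have uD : enorm u <= D.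
  rewrite /u enormZ normrN ger0_norm; last by rewrite divr_ge0 // ltW.
  have [->|vn] := eqVneq (enorm v) 0; first by rewrite mulr0; exact: ltW.
  by rewrite divfK.
pose c1 := L1 * D ^+ 2 + 2 * L1 * tube * D.
pose c2 := 5 / 2 * (eta / (1 - rho)).
have telescope : - dotp v u <= f (ybar (S 0)) - f (ybar (S T)) + T%:R * c1 +
    n%:R^-1 * (\sum_(t < T) \sum_i (dotp (noise (S t.+1) i) (abar (S t)) +
        c2 * dotp (st_g (S t.+1) i) (st_g (S t.+1) i))
      - \sum_i dotp (noise_sum T i) u
      + (2 * eta)^-1 * (potential u (S 0) - potential u (S T))).
  rewrite /v; elim: (T) => [|t IH].
    rewrite !big_ord0 dotp0l !subrr mul0r mulr0 !addr0 add0r.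
    rewrite big1 ?oppr0 ?mulr0 // => i _.
    by rewrite /noise_sum big_ord0 dotp0l.
  rewrite !big_ord_recr /= dotpDl opprD.
  have e1 : \sum_i dotp (noise_sum t.+1 i) u =
      \sum_i dotp (noise_sum t i) u + \sum_i dotp (noise (S t.+1) i) u.
    rewrite -big_split; apply: eq_bigr => i _.
    by rewrite /noise_sum big_ord_recr /= dotpDl.
  have := descent_step t uD; rewrite -/c1 -/c2 => hd.
  apply: le_trans (lerD IH hd) _; rewrite e1 [\sum_i (_ + c2 * _)]big_split /=.
  rewrite -mulr_sumr -natr1 le_eqVlt; apply/orP; left; apply/eqP; ring.
have pot0 : potential u (S 0) <= n%:R * D ^+ 2.
  have a0 i : action (S 0) i = 0.
    by rewrite /action Dh0 g0 scaler0 subrr /proj scaler0.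
  have ab0 : avg (action (S 0)) = 0.
    by rewrite /avg big1 ?scaler0 // => i _; exact: a0.
  rewrite /potential /spread [X in _ + X]big1 ?addr0 => [|i _].
    apply: (@le_trans _ _ (\sum_(i < n) D ^+ 2)); last first.
      by rewrite sumr_const card_ord mulr_natl.
    by apply: ler_sum => i _; rewrite a0 sub0r dotpNl dotpNr opprK dotp_le_sqr.
  by rewrite ab0 a0 subrr dotp0l.
have potT : 0 <= potential u (S T).
  by rewrite addr_ge0 ?spread_ge0 // sumr_ge0 // => i _; exact: dotp_ge0.
have noiseT : - \sum_i dotp (noise_sum T i) u <= n%:R * (D * b / 2) +
    \sum_(t < T) \sum_i (D / (2 * b) * dotp (noise (S t.+1) i) (noise (S t.+1) i)
      + D / b * dotp (noise (S t.+1) i) (noise_sum t i)).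
  have -> : n%:R * (D * b / 2) = \sum_(i < n) (D * b / 2).
    by rewrite sumr_const card_ord mulr_natl.
  rewrite [X in _ <= _ + X]exchange_big -sumrN -big_split /=; apply: ler_sum => i _.
  have -> : \sum_(t < T) (D / (2 * b) * dotp (noise (S t.+1) i) (noise (S t.+1) i)
      + D / b * dotp (noise (S t.+1) i) (noise_sum t i)) =
      D / (2 * b) * dotp (noise_sum T i) (noise_sum T i).
    rewrite noise_sum_sqr mulr_sumr; apply: eq_bigr => t _; field.
    by rewrite lt0r_neq0.
  rewrite -dotpNr; apply: le_trans (dotp_CS _ _) _; rewrite enormN.
  apply: le_trans (ler_wpM2l (enorm_ge0 _) uD) _; rewrite -enorm_sqr.
  set x := enorm _; rewrite -subr_ge0.
  have -> : D * b / 2 + D / (2 * b) * x ^+ 2 - x * D =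
      D / (2 * b) * (x - b) ^+ 2 by field; rewrite lt0r_neq0.
  by rewrite mulr_ge0 ?sqr_ge0 // divr_ge0 ?mulr_ge0 // ltW.
rewrite -vu; apply: le_trans telescope _.
have pot : (2 * eta)^-1 * (potential u (S 0) - potential u (S T)) <=
    n%:R * (D ^+ 2 / (2 * eta)).
  rewrite mulrA mulrC ler_wpM2r //; first by rewrite invr_ge0 mulr_ge0 ?ltW.
  by lra.
have incrE : \sum_(t < T) \sum_i increment b t i =
    \sum_(t < T) \sum_i (dotp (noise (S t.+1) i) (abar (S t)) +
        c2 * dotp (st_g (S t.+1) i) (st_g (S t.+1) i)) +
    \sum_(t < T) \sum_i (D / (2 * b) * dotp (noise (S t.+1) i) (noise (S t.+1) i)
      + D / b * dotp (noise (S t.+1) i) (noise_sum t i)).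
  rewrite -big_split; apply: eq_bigr => t _; rewrite -big_split.
  by apply: eq_bigr => i _; rewrite /increment dotpDr dotpZr -/c2 /=; ring.
have := ler_wpM2l (_ : 0 <= n%:R^-1) (lerD (lerD (lexx (\sum_(t < T) \sum_i
   (dotp (noise (S t.+1) i) (abar (S t)) +
   c2 * dotp (st_g (S t.+1) i) (st_g (S t.+1) i)))) noiseT) pot).
rewrite invr_ge0 ltW // => /(_ isT); rewrite incrE.
set A := \sum_(t < T) _; set B := \sum_(t < T) _; set N := - \sum_i _.
have -> : n%:R^-1 * (A + (n%:R * (D * b / 2) + B) + n%:R * (D ^+ 2 / (2 * eta)))
  = D * b / 2 + D ^+ 2 / (2 * eta) + n%:R^-1 * (A + B).
  by field; rewrite !lt0r_neq0.
by rewrite -/c1; lra.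
Qed.

End Pathwise.

(** * Measurability of the iterates *)

Section LowerIntegral.
Context (R : realType) (d : measure_display) (T : measurableType d).
Variable mu : {measure set T -> \bar R}.

(** The integral of a nonnegative function is a supremum over the simple functions
    below it, hence monotone even at a nonmeasurable [h] such as a Goldstein norm;
    the exceptional null set is absorbed by making the majorant infinite there. *)
Lemma ae_ge0_le_lower_integral (h g : T -> \bar R) :
  (forall x, 0 <= h x)%E -> (forall x, 0 <= g x)%E -> measurable_fun setT g ->
  {ae mu, forall x, (h x <= g x)%E} ->
  (\int[mu]_x h x <= \int[mu]_x g x)%E.
Proof.
move=> h0 g0 mg [N [mN N0 hN]].
pose g' x := if x \in N then +oo%E else g x.
have g'0 x : (0 <= g' x)%E by rewrite /g'; case: ifP.
have hg' x : (h x <= g' x)%E.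
  rewrite /g'; case: ifPn => [_|xN]; first exact: leey.
  by apply: contrapT => hg; move: xN; rewrite notin_setE; apply; exact: hN.
have mg' : measurable_fun setT g'.
  apply: measurable_fun_ifT => //; apply: (measurable_fun_bool true).
  rewrite setTI (_ : _ @^-1` _ = N) //.
  by apply/seteqP; split => x /=; [exact: set_mem|exact: mem_set].
have -> : (\int[mu]_x g x = \int[mu]_x g' x)%E.
  apply: ae_eq_integral => //; exists N; split => // x /= gg'.
  by apply: contrapT => xN; apply: gg' => _; rewrite /g' memNset.
rewrite !ge0_integralTE //; apply: le_ereal_sup => _ [k /= kh <-].
by exists k => // x; exact: le_trans (kh x) (hg' x).
Qed.

End LowerIntegral.

Section Measurability.
Context (R : realType) (d : nat).
Context (dO : measure_display) (Om : measurableType dO).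
Implicit Types (V W : Om -> 'rV[R]_d) (a : Om -> R).

(** Coordinatewise measurability, to match the tuples over which the stochastic
    gradient is jointly measurable. *)
Definition vmeas V := forall j, measurable_fun setT (fun o => V o 0 j).

Lemma vmeas_cst x : vmeas (fun=> x).
Proof. by move=> j; exact: measurable_cst. Qed.

Lemma vmeasD V W : vmeas V -> vmeas W -> vmeas (fun o => V o + W o).
Proof.
move=> mV mW j; under eq_fun do rewrite mxE.
exact: measurable_funD.
Qed.

Lemma vmeasZ a V : measurable_fun setT a -> vmeas V ->
  vmeas (fun o => a o *: V o).
Proof.
move=> ma mV j; under eq_fun do rewrite mxE.
exact: measurable_funM.
Qed.

Lemma vmeasZc (r : R) V : vmeas V -> vmeas (fun o => r *: V o).
Proof. by apply: vmeasZ; exact: measurable_cst. Qed.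

Lemma vmeasN V : vmeas V -> vmeas (fun o => - V o).
Proof.
by move=> mV; under [X in vmeas X]eq_fun do rewrite -scaleN1r; exact: vmeasZc.
Qed.

Lemma vmeasB V W : vmeas V -> vmeas W -> vmeas (fun o => V o - W o).
Proof. by move=> mV mW; apply: vmeasD => //; exact: vmeasN. Qed.

Lemma vmeas_sum (I : Type) (r : seq I) (V : I -> Om -> 'rV[R]_d) :
  (forall i, vmeas (V i)) -> vmeas (fun o => \sum_(i <- r) V i o).
Proof.
move=> mV j; under eq_fun do rewrite summxE.
by apply: measurable_sum => i; exact: mV.
Qed.

Lemma measurable_dotp V W : vmeas V -> vmeas W ->
  measurable_fun setT (fun o => dotp (V o) (W o)).
Proof. by move=> mV mW; apply: measurable_sum => j; exact: measurable_funM. Qed.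

Lemma measurable_enorm V : vmeas V -> measurable_fun setT (fun o => enorm (V o)).
Proof.
move=> mV; apply: (measurableT_comp (f := @Num.sqrt R)).
  by apply: continuous_measurable_fun; exact: sqrt_continuous.
exact: measurable_dotp.
Qed.

Lemma vmeas_proj (D : R) V : 0 < D -> vmeas V -> vmeas (fun o => proj D (V o)).
Proof.
move=> D0 mV; apply: vmeasZ => //.
apply: measurable_funM; first exact: measurable_cst.
have -> : (fun o => (Num.max D (enorm (V o)))^-1) =
  (fun r : R => (Num.max D r)^-1) \o (fun o => enorm (V o)) by [].
apply: measurableT_comp; last exact: measurable_enorm.
apply: continuous_measurable_fun => r.
apply: cvgV; first by rewrite gt_eqF // lt_max D0.
by apply: continuous_max; [exact: cvg_cst|exact: cvg_id].
Qed.

Lemma vmeas_avg n (V : 'I_n -> Om -> 'rV[R]_d) : (forall i, vmeas (V i)) ->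
  vmeas (fun o => avg (fun i => V i o)).
Proof. by move=> mV; apply: vmeasZc; exact: vmeas_sum. Qed.

Lemma vmeas_mix n (P : 'M[R]_n) (V : 'I_n -> Om -> 'rV[R]_d) i :
  (forall i, vmeas (V i)) -> vmeas (fun o => mix P (fun j => V j o) i).
Proof. by move=> mV; apply: vmeas_sum => j; exact: vmeasZc. Qed.

Lemma vmeas_random_grad (dX : measure_display) (X : measurableType dX)
    (F : 'rV[R]_d -> X -> R) (xi : Om -> X) W :
  (forall j, measurable_fun setT (fun p : d.-tuple R * X =>
     grad (F ^~ p.2) (\row_l tnth p.1 l) 0 j)) ->
  measurable_fun setT xi -> vmeas W ->
  vmeas (fun o => grad (F ^~ (xi o)) (W o)).
Proof.
move=> mF mxi mW j.
have -> : (fun o => grad (F ^~ (xi o)) (W o) 0 j) =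
    (fun p : d.-tuple R * X => grad (F ^~ p.2) (\row_l tnth p.1 l) 0 j) \o
    (fun o => ([tuple W o 0 l | l < d], xi o)).
  apply/funext => o /=; congr (grad _ _ 0 j).
  by apply/rowP => l; rewrite mxE tnth_mktuple.
apply: measurableT_comp => //; apply: measurable_fun_pair => //.
apply/measurable_fun_tnthP => l.
by rewrite (_ : _ \o _ = (fun o => W o 0 l)) //; apply/funext => o /=;
  rewrite tnth_mktuple.
Qed.

End Measurability.

Section Process.
Context (R : realType) (n d : nat) (P : 'M[R]_n) (D eta : R).
Context (dX : 'I_n -> measure_display) (X : forall i, measurableType (dX i)).
Variable F : forall i, 'rV[R]_d -> X i -> R.
Arguments F : clear implicits.
Hypothesis D_gt0 : 0 < D.
Hypothesis mF : forall i j, measurable_fun setT (fun p : d.-tuple R * X i =>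
  grad (F i ^~ p.2) (\row_l tnth p.1 l) 0 j).
Context (dO : measure_display) (Om : measurableType dO).

Definition smeas (St : Om -> state R n d) : Prop := forall i,
  [/\ vmeas (fun o => st_y (St o) i), vmeas (fun o => st_Dhalf (St o) i),
      vmeas (fun o => st_g (St o) i) & vmeas (fun o => st_w (St o) i)].

Lemma vmeas_action (St : Om -> state R n d) i : smeas St ->
  vmeas (fun o => action D eta (St o) i).
Proof.
move=> mS; have [_ mh mg _] := mS i.
by apply: vmeas_proj => //; apply: vmeasB => //; exact: vmeasZc.
Qed.

Lemma stepE (s : 'I_n -> R) z (xi : forall i, X i) (S : state R n d) :
  step P D eta 0 F s z xi S =
  let w i := st_y S i + s i *: action D eta S i in
  {| st_y := mix P (fun j => st_y S j + action D eta S j);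
     st_Dhalf := mix P (action D eta S);
     st_g := fun i => grad (F i ^~ (xi i)) (w i);
     st_w := w |}.
Proof.
have e : (fun i => argmin (eball 0 D) (fun v =>
    eta * dotp v (st_g S i) + 2^-1 * enorm (v - st_Dhalf S i) ^+ 2)) =
    action D eta S.
  by apply/funext => i; exact: argmin_proj.
rewrite /step /=; congr State.
- by apply/funext => i; rewrite -e.
- by apply/funext => i; rewrite -e.
- by apply/funext => i; rewrite scale0r addr0 -e.
- by apply/funext => i; rewrite -e.
Qed.

Lemma smeas_step (s : 'I_n -> Om -> R) z (xi : forall i, Om -> X i) St :
  (forall i, measurable_fun setT (s i)) ->
  (forall i, measurable_fun setT (xi i)) -> smeas St ->
  smeas (fun o => step P D eta 0 F (s ^~ o) (z o) (fun i => xi i o) (St o)).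
Proof.
move=> ms mxi mS i; have ma j := vmeas_action j mS.
have my j : vmeas (fun o => st_y (St o) j) by have [] := mS j.
have mw : vmeas (fun o => st_y (St o) i + s i o *: action D eta (St o) i).
  by apply: vmeasD => //; exact: vmeasZ.
split; under [X in vmeas X]eq_fun do rewrite stepE /=.
- apply: (@vmeas_mix _ _ _ _ _ P (fun j o => st_y (St o) j + action D eta (St o) j)) => j.
  exact: vmeasD.
- exact: (@vmeas_mix _ _ _ _ _ P (fun j o => action D eta (St o) j)).
- exact: vmeas_random_grad.
- by [].
Qed.

Lemma smeas_epoch (s : nat -> 'I_n -> Om -> R) z
    (xi : nat -> forall i, Om -> X i) (y0 : 'I_n -> Om -> 'rV[R]_d) t :
  (forall t' i, (t' < t)%N -> measurable_fun setT (s t' i)) ->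
  (forall t' i, (t' < t)%N -> measurable_fun setT (xi t' i)) ->
  (forall i, vmeas (y0 i)) ->
  smeas (fun o => epoch P D eta 0 F (fun t i => s t i o) (z o)
                    (fun t i => xi t i o) (y0 ^~ o) t).
Proof.
elim: t => [|t IH] ms mxi my0.
  by move=> i; split=> //=; exact: vmeas_cst.
apply: (@smeas_step (s t) (fun o => z o t) (xi t)).
- by move=> i; exact: ms.
- by move=> i; exact: mxi.
- by apply: IH => // t' i lt; [apply: ms|apply: mxi]; exact: ltnW.
Qed.

Lemma vmeas_epoch_start (s : nat -> nat -> 'I_n -> Om -> R) z
    (xi : nat -> nat -> forall i, Om -> X i) T k :
  (forall k' t i, (k' < k)%N -> (t < T)%N -> measurable_fun setT (s k' t i)) ->
  (forall k' t i, (k' < k)%N -> (t < T)%N -> measurable_fun setT (xi k' t i)) ->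
  forall i, vmeas (fun o => epoch_start P D eta 0 F (fun k t i => s k t i o)
    (z o) (fun k t i => xi k t i o) T k i).
Proof.
elim: k => [|k IH] ms mxi i; first exact: vmeas_cst.
have my := IH (fun k' t i h => ms k' t i (ltnW h)) (fun k' t i h => mxi k' t i (ltnW h)).
have /(_ i)[] // := @smeas_epoch (s k) (fun o => z o k) (xi k) _ T
  (fun t j lt => ms k t j (ltnSn k) lt) (fun t j lt => mxi k t j (ltnSn k) lt) my.
Qed.

End Process.

(** * Integrating out a fresh sample *)

Section ProductLaw.
Context (R : realType) (dO : measure_display) (Om : measurableType dO).
Context (Pr : probability Om R).
Context (d' : measure_display) (Om' : measurableType d').
Context (dX : measure_display) (X : measurableType dX) (Q : probability X R).
Variables (past : {mfun Om >-> Om'}) (xi : {mfun Om >-> X}).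
Hypothesis past_xi : forall A B, measurable A -> measurable B ->
  (Pr (past @^-1` A `&` xi @^-1` B) = Pr (past @^-1` A) * Q B)%E.

Local Open Scope ereal_scope.

(** Tonelli for a fresh draw: [past] and [xi] are jointly distributed as a
    product, so the draw can be integrated out with the past frozen. *)
Lemma integral_fresh (H : Om' * X -> \bar R) :
  measurable_fun setT H -> (forall p, 0 <= H p) ->
  \int[Pr]_o H (past o, xi o) =
  \int[distribution Pr past]_a \int[Q]_u H (a, u).
Proof.
move=> mH H0; pose pr o := (past o, xi o).
have mpr : measurable_fun setT pr by exact: measurable_fun_pair.
pose prM : {mfun Om >-> (Om' * X)%type} := HB.pack pr (isMeasurableFun.Build _ _ _ _ _ mpr).
rewrite -(fubini_tonelli1 H mH H0).
rewrite (_ : \int[Pr]_o H (past o, xi o) = \int[distribution Pr prM]_p H p).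
  apply: eq_measure_integral => A mA _.
  apply/esym; exact: product_measure_unique.
by rewrite ge0_integral_pushforward.
Qed.

(** The positive and the negative part of [H] have the same conditional mean given
    the past, hence the same integral. *)
Lemma integral_fresh_eq0 (H : Om' * X -> \bar R) :
  measurable_fun setT H ->
  (forall a, Q.-integrable setT (fun u => H (a, u))) ->
  (forall a, \int[Q]_u H (a, u) = 0) ->
  Pr.-integrable setT (fun o => H (past o, xi o)) ->
  \int[Pr]_o H (past o, xi o) = 0.
Proof.
move=> mH iH H0 iPr; rewrite integralE.
have e : \int[Pr]_o H^\+ (past o, xi o) = \int[Pr]_o H^\- (past o, xi o).
  rewrite !integral_fresh ?funepos_ge0 ?funeneg_ge0 //; last 2 first.
  - exact: measurable_funeneg.
  - exact: measurable_funepos.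
  apply: eq_integral => a _; have := H0 a; rewrite integralE.
  have fp := integrable_pos_fin_num measurableT (iH a).
  have fn := integrable_neg_fin_num measurableT (iH a).
  have key (x y : \bar R) : x \is a fin_num -> y \is a fin_num ->
      x - y = 0 -> x = y.
    by move: x y => [x| |] [y| |] // _ _ [] /eqP; rewrite subr_eq0 => /eqP ->.
  move/(key _ _ fp fn).
  by rewrite (funepos_comp H (pair a)) (funeneg_comp H (pair a)).
have fn := integrable_neg_fin_num measurableT iPr.
move: fn; rewrite (funeneg_comp H (fun o => (past o, xi o))).
rewrite (funepos_comp H (fun o => (past o, xi o))) => fn.
by rewrite [X in X - _]e subee.
Qed.

End ProductLaw.

Section Oracle.
Context (R : realType) (d : nat).
Context (dX : measure_display) (X : measurableType dX) (Q : probability X R).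
Variables (F : 'rV[R]_d -> X -> R) (h : 'rV[R]_d -> R) (sigma G : R).
Hypothesis mF : forall j, measurable_fun setT (fun p : d.-tuple R * X =>
  grad (F ^~ p.2) (\row_l tnth p.1 l) 0 j).
Hypothesis F_mean : forall x j,
  ('E_Q[fun u => (grad (F ^~ u) x 0 j)%R])%E = (grad h x 0 j)%:E.
Hypothesis F_var : forall x,
  ('E_Q[fun u => (enorm (grad (F ^~ u) x - grad h x) ^+ 2)%R]
    <= (sigma ^+ 2)%:E)%E.
Hypothesis F_sec : forall x,
  ('E_Q[fun u => (enorm (grad (F ^~ u) x) ^+ 2)%R] <= (G ^+ 2)%:E)%E.

Local Open Scope ereal_scope.

Lemma vmeas_oracle x : vmeas (fun u => grad (F ^~ u) x).
Proof. by apply: vmeas_random_grad => //; exact: vmeas_cst. Qed.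

Lemma oracle_integrable x j :
  Q.-integrable setT (fun u => (grad (F ^~ u) x 0 j)%:E).
Proof.
have mg := @vmeas_oracle x.
have iS : Q.-integrable setT (fun u => (dotp (grad (F ^~ u) x) (grad (F ^~ u) x))%:E).
  apply/integrableP; split; first by apply/measurable_EFinP; exact: measurable_dotp.
  under eq_integral do rewrite gee0_abs ?lee_fin ?dotp_ge0 // -enorm_sqr.
  by have := F_sec x; rewrite unlock => h1; apply: le_lt_trans h1 _; rewrite ltry.
have iC : Q.-integrable setT (cst 1%:E : X -> \bar R).
  exact: finite_measure_integrable_cst.
apply: le_integrable (integrableD measurableT iC iS) => //.
  by apply/measurable_EFinP; exact: mg.
move=> u _ /=; set v := grad _ _; rewrite lee_fin.
have v0 := dotp_ge0 v; rewrite [X in (_ <= X)%R]ger0_norm ?addr_ge0 //.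
have vj : (v 0 j ^+ 2 <= dotp v v)%R.
  rewrite /dotp (bigD1 j) //= -expr2 lerDl sumr_ge0 // => l _.
  by rewrite -expr2 sqr_ge0.
by rewrite ler_norml; apply/andP; split; nra.
Qed.

(** The exact gradient inherits measurability as a parametrised integral of the
    stochastic one. *)
Lemma vmeas_grad_mean (d' : measure_display) (Om' : measurableType d')
    (W : Om' -> 'rV[R]_d) : vmeas W -> vmeas (fun o => grad h (W o)).
Proof.
move=> mW j; apply/measurable_EFinP.
pose H (p : Om' * X) := (grad (F ^~ p.2) (W p.1) 0 j)%:E.
have mH : measurable_fun setT H.
  apply/measurable_EFinP.
  apply: (vmeas_random_grad (xi := snd) (W := fun p : Om' * X => W p.1) mF) => //.
  by move=> l; exact: measurableT_comp (mW l) _.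
have -> : EFin \o (fun o => grad h (W o) 0 j)%R =
    (fun o => \int[Q]_u H^\+ (o, u) - \int[Q]_u H^\- (o, u)).
  apply/funext => o /=; rewrite -F_mean unlock integralE.
  by rewrite (funepos_comp H (pair o)) (funeneg_comp H (pair o)).
apply: emeasurable_funB; apply: measurable_fun_fubini_tonelli_F => //.
- exact: measurable_funepos.
- exact: measurable_funeneg.
Qed.

Context (dO : measure_display) (Om : measurableType dO) (Pr : probability Om R).
Context (d' : measure_display) (Om' : measurableType d').
Variables (past : {mfun Om >-> Om'}) (xi : {mfun Om >-> X}).
Hypothesis past_xi : forall A B, measurable A -> measurable B ->
  Pr (past @^-1` A `&` xi @^-1` B) = Pr (past @^-1` A) * Q B.

Lemma integral_fresh_le (H : Om' * X -> \bar R) (c : R) :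
  measurable_fun setT H -> (forall p, 0 <= H p) ->
  (forall a, \int[Q]_u H (a, u) <= c%:E) -> \int[Pr]_o H (past o, xi o) <= c%:E.
Proof.
move=> mH H0 Hc; rewrite (integral_fresh past_xi) //.
apply: (@le_trans _ _ (\int[distribution Pr past]_a cst c%:E a)).
  apply: ge0_le_integral => //.
  - by move=> a _; exact: integral_ge0.
  - exact: measurable_fun_fubini_tonelli_F.
rewrite integral_cst // [X in _ * X](_ : _ = 1) ?mule1 //.
exact: (probability_setT (distribution Pr past)).
Qed.

Variables (W phi : Om' -> 'rV[R]_d).
Hypotheses (mW : vmeas W) (mphi : vmeas phi).

Let g (p : Om' * X) := grad (F ^~ p.2) (W p.1).
Let m (p : Om' * X) := (grad h (W p.1) - g p)%R.

Let mg : vmeas g.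
Proof.
apply: (vmeas_random_grad (xi := snd) (W := fun p : Om' * X => W p.1) mF) => //.
by move=> l; exact: measurableT_comp (mW l) _.
Qed.

Let mm : vmeas m.
Proof.
apply: vmeasB => //; apply: vmeas_grad_mean.
by move=> l; exact: measurableT_comp (mW l) _.
Qed.

Lemma oracle_second_moment : \int[Pr]_o
  (dotp (g (past o, xi o)) (g (past o, xi o)))%:E <= (G ^+ 2)%:E.
Proof.
apply: (@integral_fresh_le (fun p => (dotp (g p) (g p))%:E)).
- by apply/measurable_EFinP; exact: measurable_dotp.
- by move=> p; rewrite lee_fin dotp_ge0.
- move=> a; have := F_sec (W a); rewrite unlock.
  by under eq_integral do rewrite enorm_sqr.
Qed.

Lemma noise_second_moment : \int[Pr]_o
  (dotp (m (past o, xi o)) (m (past o, xi o)))%:E <= (sigma ^+ 2)%:E.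
Proof.
apply: (@integral_fresh_le (fun p => (dotp (m p) (m p))%:E)).
- by apply/measurable_EFinP; exact: measurable_dotp.
- by move=> p; rewrite lee_fin dotp_ge0.
- move=> a; have := F_var (W a); rewrite unlock.
  by under eq_integral do rewrite enormC enorm_sqr.
Qed.

Lemma sqr_integrable (V : Om -> 'rV[R]_d) (c : R) : vmeas V ->
  \int[Pr]_o (dotp (V o) (V o))%:E <= c%:E ->
  Pr.-integrable setT (fun o => (dotp (V o) (V o))%:E).
Proof.
move=> mV hc; apply/integrableP; split.
  by apply/measurable_EFinP; exact: measurable_dotp.
under eq_integral do rewrite gee0_abs ?lee_fin ?dotp_ge0 //.
by apply: le_lt_trans hc _; rewrite ltry.
Qed.

Hypothesis phi2 :
  Pr.-integrable setT (fun o => (dotp (phi (past o)) (phi (past o)))%:E).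

Let mmP : vmeas (fun o => m (past o, xi o)).
Proof.
by move=> j; apply: (measurableT_comp (mm j)); exact: measurable_fun_pair.
Qed.

Let mgP : vmeas (fun o => g (past o, xi o)).
Proof.
by move=> j; apply: (measurableT_comp (mg j)); exact: measurable_fun_pair.
Qed.

Lemma noise_orthogonal_integrable :
  Pr.-integrable setT (fun o => (dotp (m (past o, xi o)) (phi (past o)))%:E).
Proof.
have im := sqr_integrable mmP noise_second_moment.
apply: le_integrable (integrableD measurableT im phi2) => //.
  apply/measurable_EFinP; apply: measurable_dotp => // j.
  exact: measurableT_comp (mphi j) _.
move=> o _ /=; move: (m _) (phi _) => x y.
rewrite lee_fin.
have hx := dotp_ge0 x; have hy := dotp_ge0 y.
rewrite [X in (_ <= X)%R]ger0_norm ?addr_ge0 //.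
have := dotp_ge0 (x - y)%R; have := dotp_ge0 (x + y)%R.
rewrite !dotpE (dotpC y x) => h1 h2.
by rewrite ler_norml; apply/andP; split; lra.
Qed.

(** The noise of a fresh draw is orthogonal to everything already known. *)
Lemma noise_orthogonal :
  \int[Pr]_o (dotp (m (past o, xi o)) (phi (past o)))%:E = 0.
Proof.
have Hi a j : Q.-integrable setT (fun u => (m (a, u) 0 j * phi a 0 j)%:E).
  rewrite (_ : (fun u => _) = (fun u => (phi a 0 j)%:E *
      ((grad h (W a) 0 j)%:E - (grad (F ^~ u) (W a) 0 j)%:E))); last first.
    by apply/funext => u; rewrite -EFinB -EFinM /m !mxE mulrC.
  apply: integrableZl => //; apply: integrableB => //.
    exact: finite_measure_integrable_cst.
  exact: oracle_integrable.
have sumE a u : (dotp (m (a, u)) (phi a))%:E = \sum_(j < d) (m (a, u) 0 j * phi a 0 j)%:E.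
  by rewrite sumEFin.
apply: (integral_fresh_eq0 past_xi (H := fun p => (dotp (m p) (phi p.1))%:E)).
- apply/measurable_EFinP; apply: measurable_dotp => // j.
  exact: measurableT_comp (mphi j) _.
- move=> a; rewrite (_ : (fun u => _) = fun u => \sum_(j < d) (m (a, u) 0 j * phi a 0 j)%:E).
    exact: integrable_sum.
  by apply/funext => u; exact: sumE.
- move=> a; under eq_integral do rewrite sumE.
  rewrite integral_sum // big1 // => j _.
  under eq_integral => u _.
    rewrite (_ : (m (a, u) 0 j * phi a 0 j)%:E = (phi a 0 j)%:E *
      ((grad h (W a) 0 j)%:E - (grad (F ^~ u) (W a) 0 j)%:E)); last first.
      by rewrite -EFinB -EFinM /m !mxE mulrC.
    over.
  have ic : Q.-integrable setT (fun=> (grad h (W a) 0 j)%:E).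
    exact: finite_measure_integrable_cst.
  rewrite integralZl //; last by apply: integrableB => //; exact: oracle_integrable.
  rewrite integralB //; last exact: oracle_integrable.
  have -> : \int[Q]__ (grad h (W a) 0 j)%:E = (grad h (W a) 0%R j)%:E.
    rewrite -[RHS]mule1 -(probability_setT Q).
    exact: (integral_cst Q measurableT).
  have := F_mean (W a) j; rewrite unlock => ->.
  by rewrite -EFinB subrr mule0.
- exact: noise_orthogonal_integrable.
Qed.

(** The three ways in which one oracle call enters the epoch bound: noise against
    the past, squared noise, and squared gradient. *)
Lemma oracle_increment (a2 a3 : R) : (0 <= a2)%R -> (0 <= a3)%R ->
  let Z o := (dotp (m (past o, xi o)) (phi (past o))
      + a2 * dotp (m (past o, xi o)) (m (past o, xi o))
      + a3 * dotp (g (past o, xi o)) (g (past o, xi o)))%R in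
  Pr.-integrable setT (EFin \o Z) /\
  \int[Pr]_o (Z o)%:E <= (a2 * sigma ^+ 2 + a3 * G ^+ 2)%:E.
Proof.
move=> a20 a30 Z.
have i1 := noise_orthogonal_integrable.
have i2 := sqr_integrable mmP noise_second_moment.
have i3 := sqr_integrable mgP oracle_second_moment.
have i2' := integrableZl measurableT a2 i2.
have i3' := integrableZl measurableT a3 i3.
have ZE : EFin \o Z = (fun o => (dotp (m (past o, xi o)) (phi (past o)))%:E
   + a2%:E * (dotp (m (past o, xi o)) (m (past o, xi o)))%:E
   + a3%:E * (dotp (g (past o, xi o)) (g (past o, xi o)))%:E).
  by apply/funext => o /=; rewrite /Z !EFinD !EFinM.
have i12 := integrableD measurableT i1 i2'.
have i123 := integrableD measurableT i12 i3'.
split; first by rewrite ZE.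
rewrite (_ : \int[Pr]_o (Z o)%:E = \int[Pr]_o (EFin \o Z) o) // ZE.
rewrite (integralD measurableT i12 i3') (integralD measurableT i1 i2').
rewrite noise_orthogonal add0e !integralZl // EFinD !EFinM.
apply: leeD; apply: lee_wpmul2l; rewrite ?lee_fin //.
- exact: noise_second_moment.
- exact: oracle_second_moment.
Qed.

End Oracle.

(** * Independence of a draw from all the others *)

Section Independence.
Context (R : realType) (dO : measure_display) (Om : measurableType dO).
Variable Pr : probability Om R.

(** Independence of an event passes from a pi-system to the sigma-algebra that
    it generates: both sides are finite measures in [A]. *)
Lemma independent_generated (G : set (set Om)) (B : set Om) :
  G `<=` measurable -> setI_closed G -> G setT -> measurable B ->
  (forall A, G A -> Pr (A `&` B) = (Pr A * Pr B)%E) ->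
  forall A, <<s G >> A -> Pr (A `&` B) = (Pr A * Pr B)%E.
Proof.
move=> Gm GI GT mB GB A sA.
have PB : (Pr B \is a fin_num)%E by exact: fin_num_measure.
have r0 : 0 <= fine (Pr B) by exact: fine_ge0.
have h : (mrestr Pr mB A = mscale (NngNum r0) Pr A)%E.
  apply: (@g_sigma_algebra_measure_unique _ _ _ G Gm (fun=> setT)) => //.
  - by apply/seteqP; split => // x _; exists 0%N.
  - move=> C GC; transitivity (Pr (C `&` B)) => //.
    by rewrite GB // muleC -[X in (X * _)%E](fineK PB).
  - move=> _; change (Pr (setT `&` B) < +oo)%E.
    by rewrite setTI ltey_eq PB.
by rewrite muleC -[X in (X * _)%E](fineK PB).
Qed.

Context (J : finType) (H : J -> set (set Om)) (j0 : J).
Hypothesis H_meas : forall j, H j `<=` measurable.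
Hypothesis H_setI : forall j, setI_closed (H j).
Hypothesis H_setT : forall j, H j setT.
Hypothesis H_ind : independent_sigma Pr H.

(** The events that can be described without [j0]: a pi-system generating the
    join of all the other sigma-algebras. *)
Definition others : set (set Om) :=
  [set A | exists E : J -> set Om, [/\ forall j, H j (E j), E j0 = setT &
     A = \bigcap_(j in [set: J]) E j]].

Lemma others_meas : others `<=` measurable.
Proof.
move=> _ [E [HE _ ->]]; apply: fin_bigcap_measurable => [|j _].
  exact: finite_finset.
exact/H_meas/HE.
Qed.

Lemma others_setI : setI_closed others.
Proof.
move=> _ _ [E [HE E0 ->]] [E' [HE' E'0 ->]].
exists (fun j => E j `&` E' j); split.
- by move=> j; exact: H_setI.
- by rewrite E0 E'0 setTI.
- by rewrite bigcapI.
Qed.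

Lemma others_sub j A : j != j0 -> H j A -> others A.
Proof.
move=> jj0 HA; exists (fun i => if i == j then A else setT); split.
- by move=> i; case: eqP => [->|].
- by rewrite eq_sym (negPf jj0).
- apply/seteqP; split => [x Ax i _|x /(_ j I)]; last by rewrite eqxx.
  by case: ifP.
Qed.

Lemma others_setT : others setT.
Proof.
exists (fun=> setT); split => //.
by apply/seteqP; split.
Qed.

Lemma others_independent A B : <<s others >> A -> H j0 B ->
  Pr (A `&` B) = (Pr A * Pr B)%E.
Proof.
move=> sA HB; apply: independent_generated sA => //.
- exact: others_meas.
- exact: others_setI.
- exact: others_setT.
- exact: H_meas HB.
move=> _ [E [HE E0 ->]].
pose E' j := if j == j0 then B else E j.
have -> : \bigcap_(j in [set: J]) E j `&` B = \bigcap_(j in [set: J]) E' j.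
  apply/seteqP; split => [x [xE xB] j _|x xE'].
    by rewrite /E'; case: ifP => // _; exact: xE.
  split=> [j _|]; last by have := xE' j0 I; rewrite /E' eqxx.
  by have := xE' j I; rewrite /E'; case: eqP => // ->; rewrite E0.
rewrite !H_ind //; last by move=> j; rewrite /E'; case: eqP => [->|].
rewrite -(fineK (fin_num_measure Pr B (H_meas HB))) -EFinM; congr EFin.
rewrite (bigD1 j0) //= [X in _ = X * _](bigD1 j0) //=.
rewrite {1}/E' eqxx E0 probability_setT /= mul1r mulrC; congr (_ * _).
by apply: eq_bigr => j jj0; rewrite /E' (negPf jj0).
Qed.

Lemma measurable_past :
  measurable_fun setT (idfun : Om -> g_sigma_algebraType others).
Proof.
move=> _ A mA; rewrite setTI preimage_id.
exact: (smallest_sub (@sigma_algebra_measurable _ Om) others_meas).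
Qed.

Definition past : {mfun Om >-> g_sigma_algebraType others} :=
  HB.pack (idfun : Om -> g_sigma_algebraType others)
    (isMeasurableFun.Build _ _ _ _ _ measurable_past).

End Independence.

(** * Expected gradient over a run *)

Section Run.
Context (R : realType) (n d : nat) (P : 'M[R]_n) (D eta : R).
Context (dX : 'I_n -> measure_display) (X : forall i, measurableType (dX i)).
Variable F : forall i, 'rV[R]_d -> X i -> R.
Arguments F : clear implicits.
Hypothesis D_gt0 : 0 < D.

Definition run (s : nat -> nat -> 'I_n -> R) (z : nat -> nat -> 'I_n -> 'rV[R]_d)
    (xi : nat -> nat -> forall i, X i) (T k t : nat) : state R n d :=
  epoch P D eta 0 F (s k) (z k) (xi k) (epoch_start P D eta 0 F s z xi T k) t.

Lemma run_step s z xi T k t : run s z xi T k t.+1 =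
  step P D eta 0 F (s k t) (z k t) (xi k t) (run s z xi T k t).
Proof. by []. Qed.

Lemma run_trajectory s z xi T k : (forall t i, 0 <= s k t i <= 1) ->
  trajectory P D eta (run s z xi T k).
Proof.
move=> s01 t i; rewrite run_step stepE //; split=> //=.
rewrite addrAC subrr add0r enormZ.
have /andP[s0 s1] := s01 t i; rewrite ger0_norm //.
apply: le_trans (action_in eta D_gt0 (run s z xi T k t) i).
by rewrite ler_piMl // enorm_ge0.
Qed.

Hypothesis mF : forall i j, measurable_fun setT (fun p : d.-tuple R * X i =>
  grad (F i ^~ p.2) (\row_l tnth p.1 l) 0 j).

Lemma smeas_run (dO : measure_display) (Om : measurableType dO)
    (s : nat -> nat -> 'I_n -> Om -> R) z
    (xi : nat -> nat -> forall i, Om -> X i) T k t :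
  (forall k' t' i, (k' < k)%N && (t' < T)%N || (k' == k) && (t' < t)%N ->
     measurable_fun setT (s k' t' i) /\ measurable_fun setT (xi k' t' i)) ->
  smeas (fun o => run (fun k t i => s k t i o) (z o)
                      (fun k t i => xi k t i o) T k t).
Proof.
move=> m; apply: (@smeas_epoch _ _ _ P D eta _ _ F D_gt0 mF _ Om (s k)
  (fun o => z o k) (xi k) (fun i o => epoch_start P D eta 0 F
  (fun k t i => s k t i o) (z o) (fun k t i => xi k t i o) T k i)).
- by move=> t' i lt; have [] := m k t' i; rewrite ?eqxx ?lt ?orbT.
- by move=> t' i lt; have [] := m k t' i; rewrite ?eqxx ?lt ?orbT.
- apply: vmeas_epoch_start => // k' t' i lk lt;
  by have [] := m k' t' i; rewrite ?lk ?lt.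
Qed.

End Run.

Section SquareIntegrable.
Context (R : realType) (d : nat) (dO : measure_display) (Om : measurableType dO).
Variable Pr : probability Om R.

Definition sqint (V : Om -> 'rV[R]_d) : Prop :=
  Pr.-integrable setT (fun o => (dotp (V o) (V o))%:E).

Lemma sqintD (V W : Om -> 'rV[R]_d) : vmeas V -> vmeas W -> sqint V -> sqint W ->
  sqint (fun o => V o + W o).
Proof.
move=> mV mW iV iW.
have iV2 := integrableZl measurableT 2 iV.
have iW2 := integrableZl measurableT 2 iW.
apply: le_integrable (integrableD measurableT iV2 iW2) => //.
  by apply/measurable_EFinP; apply: measurable_dotp; exact: vmeasD.
move=> o _ /=; rewrite lee_fin ger0_norm ?dotp_ge0 // ger0_norm.
  exact: dotpD_le2.
by rewrite addr_ge0 // mulr_ge0 // dotp_ge0.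
Qed.

Lemma sqint_bounded (V : Om -> 'rV[R]_d) (D : R) : vmeas V ->
  (forall o, enorm (V o) <= D) -> sqint V.
Proof.
move=> mV VD.
have iC : Pr.-integrable setT (cst (D ^+ 2)%:E : Om -> \bar R).
  exact: finite_measure_integrable_cst.
apply: le_integrable iC => //.
  by apply/measurable_EFinP; exact: measurable_dotp.
move=> o _ /=; rewrite lee_fin ger0_norm ?dotp_ge0 // ger0_norm ?sqr_ge0 //.
exact: dotp_le_sqr.
Qed.

Lemma sqintZ (V : Om -> 'rV[R]_d) (c : R) : sqint V -> sqint (fun o => c *: V o).
Proof.
move=> iV; have := integrableZl measurableT (c ^+ 2) iV.
rewrite /sqint; congr (_.-integrable _ _); apply/funext => o /=.
by rewrite dotpZl dotpZr mulrA -expr2 EFinM.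
Qed.

Lemma sqint_sum (I : Type) (r : seq I) (V : I -> Om -> 'rV[R]_d) :
  (forall i, vmeas (V i)) -> (forall i, sqint (V i)) ->
  sqint (fun o => \sum_(i <- r) V i o).
Proof.
move=> mV iV; elim: r => [|i r IH].
  under [X in sqint X]eq_fun do rewrite big_nil.
  by apply: (@sqint_bounded _ 0) => [|o]; [exact: vmeas_cst|rewrite enorm0].
under [X in sqint X]eq_fun do rewrite big_cons.
by apply: sqintD => //; exact: vmeas_sum.
Qed.

End SquareIntegrable.

Section Expectation.
Context (R : realType) (n d : nat) (P : 'M[R]_n) (rho D eta b sigma G L1 : R).
Context (dX : 'I_n -> measure_display) (X : forall i, measurableType (dX i)).
Context (Q : forall i, probability (X i) R).
Variable F : forall i, 'rV[R]_d -> X i -> R.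
Arguments F : clear implicits.
Variable h : 'I_n -> 'rV[R]_d -> R.
Hypotheses (n_gt0 : (0 < n)%N) (D_gt0 : 0 < D) (eta_gt0 : 0 < eta).
Hypotheses (b_gt0 : 0 < b) (rho01 : 0 <= rho < 1).
Hypothesis mF : forall i j, measurable_fun setT (fun p : d.-tuple R * X i =>
  grad (F i ^~ p.2) (\row_l tnth p.1 l) 0 j).
Hypothesis F_mean : forall i x j,
  ('E_(Q i)[fun u => (grad (F i ^~ u) x 0 j)%R])%E = (grad (h i) x 0 j)%:E.
Hypothesis F_var : forall i x,
  ('E_(Q i)[fun u => (enorm (grad (F i ^~ u) x - grad (h i) x) ^+ 2)%R]
    <= (sigma ^+ 2)%:E)%E.
Hypothesis F_sec : forall i x,
  ('E_(Q i)[fun u => (enorm (grad (F i ^~ u) x) ^+ 2)%R] <= (G ^+ 2)%:E)%E.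

Context (dO : measure_display) (Om : measurableType dO) (Pr : probability Om R).
Variables (K T : nat) (s : nat -> nat -> 'I_n -> {mfun Om >-> R}).
Variable z : nat -> nat -> 'I_n -> Om -> 'rV[R]_d.
Variable xi : nat -> nat -> forall i, {mfun Om >-> X i}.
Arguments xi : clear implicits.
Hypothesis xi_law : forall k t i, (k < K)%N -> (t < T)%N ->
  has_law Pr (xi k t i) (Q i).
Hypothesis indep : independent_sigma Pr (@draw_sigma R n K T dO Om dX X s xi).

(** Forces the uniform draws into [0, 1] on the null set where they leave it, so
    that the pathwise bounds hold for every outcome. *)
Definition clamp (r : R) : R := Num.min 1 (Num.max 0 r).

Let H := @draw_sigma R n K T dO Om dX X s xi.
Let sc k t i (o : Om) : R := clamp (s k t i o).

Definition clamped_run k t o : state R n d :=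
  run P D eta F (fun k t i => clamp (s k t i o)) (fun k t i => z k t i o)
    (fun k t i => xi k t i o) T k t.

Lemma draw_meas j : H j `<=` measurable.
Proof.
case: j => -[[k t] i] A /= [B mB <-]; rewrite setTI -[_ @^-1` _]setTI.
  exact: (measurable_funP (s k t i)).
exact: (measurable_funP (xi k t i)).
Qed.

Lemma draw_setI j : setI_closed (H j).
Proof.
case: j => -[[k t] i] A B /= [A' mA <-] [B' mB <-];
  by exists (A' `&` B'); [exact: measurableI|rewrite !setTI preimage_setI].
Qed.

Lemma draw_setT j : H j setT.
Proof.
by case: j => -[[k t] i] /=; exists setT; rewrite ?setTI ?preimage_setT.
Qed.

Lemma measurable_clamp (d' : measure_display) (Om' : measurableType d')
    (f : Om' -> R) : measurable_fun setT f -> measurable_fun setT (clamp \o f).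
Proof.
move=> mf; apply: measurable_minr; first exact: measurable_cst.
by apply: measurable_maxr => //; exact: measurable_cst.
Qed.

Section OneCall.
Variables (k : 'I_K) (t : 'I_T) (i : 'I_n).
Let j0 : 'I_K * 'I_T * 'I_n + 'I_K * 'I_T * 'I_n := inr (k, t, i).
Let Om' := g_sigma_algebraType (others H j0).

Let ms k' t' i' : (k' < K)%N -> (t' < T)%N ->
  measurable_fun setT (sc k' t' i' : Om' -> R).
Proof.
move=> lk lt; apply: (@measurable_clamp _ Om' (s k' t' i')) => _ A mA.
apply: sub_sigma_algebra.
apply: (@others_sub _ _ _ H j0 draw_setT (inl (Ordinal lk, Ordinal lt, i'))) => //.
by exists A.
Qed.

Let mxi k' t' i' : (k' < K)%N -> (t' < T)%N ->
  (k' != k :> nat) || (t' != t :> nat) ->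
  measurable_fun setT (xi k' t' i' : Om' -> X i').
Proof.
move=> lk lt ne _ A mA; apply: sub_sigma_algebra.
apply: (@others_sub _ _ _ H j0 draw_setT (inr (Ordinal lk, Ordinal lt, i'))).
  apply/eqP => -[/(congr1 val) /= ek /(congr1 val) /= et _].
  by move: ne; rewrite ek et !eqxx.
by exists A.
Qed.

Lemma past_smeas t' : (t' <= t)%N -> smeas (clamped_run k t' : Om' -> state R n d).
Proof.
move=> le; apply: (@smeas_run _ _ _ P D eta _ _ F D_gt0 mF _ Om' sc
  (fun o k t i => z k t i o) xi) => k' u i' /orP[/andP[lk lu]|/andP[/eqP -> lu]].
- split; [apply: ms => //|apply: mxi => //]; try exact: ltn_trans lk _.
  by rewrite neq_ltn lk.
- have lt : (u < t)%N by exact: leq_trans lu le.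
  split; [apply: ms => //|apply: mxi => //]; try exact: ltn_trans lt _.
  by rewrite orbC neq_ltn lt.
Qed.

(** The query point of agent [i]: its own uniform draw is allowed, its own
    sample is not. *)
Let W (o : Om') := st_y (clamped_run k t o) i + sc k t i o *: action D eta (clamped_run k t o) i.

Let mW : vmeas W.
Proof.
have mS := past_smeas (leqnn t); apply: vmeasD; first by have [] := mS i.
by apply: vmeasZ; [exact: ms|exact: vmeas_action].
Qed.

Let pst := past j0 draw_meas.

Let past_fresh A B : measurable A -> measurable B ->
  Pr (pst @^-1` A `&` xi k t i @^-1` B) = (Pr (pst @^-1` A) * Q i B)%E.
Proof.
move=> mA mB; rewrite -(@xi_law k t i (ltn_ord k) (ltn_ord t) _ mB).
apply: (@others_independent _ _ _ Pr _ H j0 draw_meas draw_setI draw_setT indep).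
  exact: mA.
by exists B => //; rewrite setTI.
Qed.

Lemma noiseE o : noise h (clamped_run k t.+1 o) i =
  grad (h i) (W o) - grad (F i ^~ (xi k t i o)) (W o).
Proof. by rewrite /noise /clamped_run run_step stepE. Qed.

Lemma st_gE o : st_g (clamped_run k t.+1 o) i = grad (F i ^~ (xi k t i o)) (W o).
Proof. by rewrite /clamped_run run_step stepE. Qed.

Lemma noise_mean_sqr :
  (\int[Pr]_o (dotp (noise h (clamped_run k t.+1 o) i) (noise h (clamped_run k t.+1 o) i))%:E
    <= (sigma ^+ 2)%:E)%E.
Proof.
under eq_integral do rewrite noiseE.
exact: (noise_second_moment (@mF i) (@F_mean i) (@F_var i) past_fresh mW).
Qed.

(** [phi] stands for any vector computed before the sample [xi k t i] is drawn. *)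
Lemma fresh_increment (phi : Om -> 'rV[R]_d) (a2 a3 : R) :
  vmeas (phi : Om' -> 'rV[R]_d) -> sqint Pr phi -> 0 <= a2 -> 0 <= a3 ->
  let Z o := dotp (noise h (clamped_run k t.+1 o) i) (phi o)
    + a2 * dotp (noise h (clamped_run k t.+1 o) i) (noise h (clamped_run k t.+1 o) i)
    + a3 * dotp (st_g (clamped_run k t.+1 o) i) (st_g (clamped_run k t.+1 o) i) in
  Pr.-integrable setT (EFin \o Z) /\
  (\int[Pr]_o (Z o)%:E <= (a2 * sigma ^+ 2 + a3 * G ^+ 2)%:E)%E.
Proof.
move=> mphi iphi a20 a30.
move=> Z.
have e : Z =
  (fun o => dotp (grad (h i) (W o) - grad (F i ^~ (xi k t i o)) (W o)) (phi o)
    + a2 * dotp (grad (h i) (W o) - grad (F i ^~ (xi k t i o)) (W o))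
                (grad (h i) (W o) - grad (F i ^~ (xi k t i o)) (W o))
    + a3 * dotp (grad (F i ^~ (xi k t i o)) (W o))
                (grad (F i ^~ (xi k t i o)) (W o))).
  by apply/funext => o; rewrite /Z noiseE st_gE.
rewrite {}e; clear Z.
move: (W) (mW) => V mV.
exact: (oracle_increment (@mF i) (@F_mean i) (@F_var i) (@F_sec i) past_fresh
  mV mphi iphi a20 a30).
Qed.

End OneCall.

Lemma vmeas_noise (d' : measure_display) (Om' : measurableType d')
    (St : Om' -> state R n d) i : smeas St -> vmeas (fun o => noise h (St o) i).
Proof.
move=> mS; have [_ _ mg mw] := mS i.
by apply: vmeasB => //; exact: (vmeas_grad_mean (@mF i) (@F_mean i)).
Qed.

Lemma smeas_clamped_run k t : (k < K)%N -> (t <= T)%N ->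
  smeas (clamped_run k t : Om -> state R n d).
Proof.
move=> lk lt; apply: (@smeas_run _ _ _ P D eta _ _ F D_gt0 mF _ Om sc
  (fun o k t i => z k t i o) xi) => k' u i _; split.
  apply: (@measurable_clamp _ Om (s k' u i)).
  exact: measurable_funP.
exact: measurable_funP.
Qed.

Lemma noise_sqint (k : 'I_K) (t : 'I_T) i :
  sqint Pr (fun o => noise h (clamped_run k t.+1 o) i).
Proof.
apply: sqr_integrable (noise_mean_sqr k t i).
by apply: vmeas_noise; exact: smeas_clamped_run.
Qed.

(** The noise accumulated so far and the current averaged action are functions of
    the past. *)
Lemma increment_mean (k : 'I_K) (t : 'I_T) i :
  let Z o := increment rho D eta (fun u => clamped_run k u o) h b t i in
  Pr.-integrable setT (EFin \o Z) /\
  (\int[Pr]_o (Z o)%:E <= (D / (2 * b) * sigma ^+ 2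
     + 5 / 2 * (eta / (1 - rho)) * G ^+ 2)%:E)%E.
Proof.
have q0 : 0 <= eta / (1 - rho).
  by case/andP: rho01 => _ r1; rewrite divr_ge0 ?subr_ge0 // ltW.
apply: (@fresh_increment k t i
  (fun o => abar D eta (clamped_run k t o) + (D / b) *: noise_sum (fun u => clamped_run k u o) h t i)).
- apply: vmeasD.
    apply: vmeas_avg => j; apply: vmeas_action => //; exact: past_smeas.
  apply: vmeasZc; apply: vmeas_sum => u; apply: vmeas_noise.
  apply: past_smeas; exact: ltn_ord.
- apply: sqintD.
  + apply: vmeas_avg => j; apply: vmeas_action => //; apply: smeas_clamped_run => //.
    exact: ltnW.
  + apply: vmeasZc; apply: vmeas_sum => u; apply: vmeas_noise; apply: smeas_clamped_run => //.
    exact: leq_trans (ltn_ord u) (ltnW (ltn_ord t)).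
  + apply: (@sqint_bounded _ _ _ _ _ _ D) => [|o]; last exact: abar_in.
    apply: vmeas_avg => j; apply: vmeas_action => //; apply: smeas_clamped_run => //.
    exact: ltnW.
  + apply: sqintZ; apply: sqint_sum => u.
      apply: vmeas_noise; apply: smeas_clamped_run => //.
      exact: leq_trans (ltn_ord u) (ltnW (ltn_ord t)).
    have ut : (u < T)%N by exact: ltn_trans (ltn_ord u) (ltn_ord t).
    exact: (noise_sqint k (Ordinal ut) i).
- by rewrite divr_ge0 ?mulr_ge0 // ltW.
- by rewrite mulr_ge0.
Qed.

Hypotheses (P_sym : P^T = P) (P_ds : doubly_stochastic P).
Hypothesis P_rho : second_singular_value P rho.
Hypotheses (L1_ge0 : 0 <= L1) (h_smooth : forall i, smooth L1 (h i)).
Hypothesis T_gt0 : (0 < T)%N.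
Variable gam : R.
Let f (x : 'rV[R]_d) : R := n%:R^-1 * \sum_i h i x.
Hypothesis f_gap : forall x, f 0 - f x <= gam.

Lemma clamp01 r : 0 <= clamp r <= 1.
Proof. by rewrite /clamp le_min ge_min lexx le_max lexx ler01. Qed.

Lemma clamped_trajectory k o :
  trajectory P D eta (fun t => clamped_run k t o).
Proof. by apply: run_trajectory => // t i; exact: clamp01. Qed.

(** The disagreement is carried over from one epoch to the next. *)
Lemma start_spread k o :
  spread (st_y (clamped_run k 0 o)) <= (rho * tube n rho D) ^+ 2.
Proof.
elim: k => [|k IH].
  rewrite /spread big1 ?sqr_ge0 // => i _.
  by rewrite /avg big1 // scaler0 subrr dotp0l.
have := spread_y n_gt0 D_gt0 P_sym P_ds P_rho rho01 (clamped_trajectory k o) T IH.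
by [].
Qed.

Definition epoch_grad k o : R :=
  enorm (avg (fun t : 'I_T => grad f (ybar (clamped_run k t o)))).

Let c0 : R := T%:R * (L1 * D ^+ 2 + 2 * L1 * tube n rho D * D) + D * b / 2
  + D ^+ 2 / (2 * eta).

Lemma epochs_bound o :
  D * T%:R * \sum_(k < K) epoch_grad k o <= gam + K%:R * c0 +
  n%:R^-1 * \sum_(k < K) \sum_(t < T) \sum_i
    increment rho D eta (fun u => clamped_run k u o) h b t i.
Proof.
have TR : T%:R != 0 :> R by rewrite pnatr_eq0 -lt0n.
have step k : D * T%:R * epoch_grad k o <=
    f (ybar (clamped_run k 0 o)) - f (ybar (clamped_run k.+1 0 o)) + c0 +
    n%:R^-1 * \sum_(t < T) \sum_i
      increment rho D eta (fun u => clamped_run k u o) h b t i.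
  have := epoch_bound n_gt0 D_gt0 eta_gt0 P_sym P_ds P_rho rho01
    (clamped_trajectory k o) L1_ge0 h_smooth (start_spread k o) T b_gt0
    (fun=> erefl) (fun=> erefl).
  apply: le_trans; rewrite /epoch_grad /avg enormZ ger0_norm ?invr_ge0 //.
  by rewrite -mulrA mulVKf.
have tel : D * T%:R * \sum_(k < K) epoch_grad k o <=
    f (ybar (clamped_run 0 0 o)) - f (ybar (clamped_run K 0 o)) + K%:R * c0 +
    n%:R^-1 * \sum_(k < K) \sum_(t < T) \sum_i
    increment rho D eta (fun u => clamped_run k u o) h b t i.
  elim: (K) => [|m IH]; first by rewrite !big_ord0 !(mulr0, mul0r) subrr !addr0.
  rewrite !big_ord_recr /= -natr1; have := step m; move: IH.
  by clearbody c0; lra.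
apply: le_trans tel _; rewrite !lerD2r.
have -> : ybar (clamped_run 0 0 o) = 0.
  by rewrite /ybar /avg big1 ?scaler0.
exact: f_gap.
Qed.

Lemma measurable_epoch_grad (k : 'I_K) : measurable_fun setT (epoch_grad k).
Proof.
apply: measurable_enorm; apply: vmeas_avg => t.
have -> : (fun o => grad f (ybar (clamped_run k t o))) =
    (fun o => avg (fun i => grad (h i) (ybar (clamped_run k t o)))).
  by apply/funext => o; rewrite (grad_f h_smooth).
apply: vmeas_avg => i; apply: (vmeas_grad_mean (@mF i) (@F_mean i)).
apply: vmeas_avg => j; have lt := ltnW (ltn_ord t).
by have [] := smeas_clamped_run (ltn_ord k) lt j.
Qed.

(** The pathwise bound summed over all epochs and integrated: the decreases of [f]
    telescope, and each oracle call is averaged with its own past frozen. *)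
Lemma expected_gradient :
  ((D * T%:R)%:E * \sum_(k < K) \int[Pr]_o (epoch_grad k o)%:E <=
  (gam + K%:R * c0 + K%:R * (T%:R * (D / (2 * b) * sigma ^+ 2
     + 5 / 2 * (eta / (1 - rho)) * G ^+ 2)))%:E)%E.
Proof.
set cz := D / (2 * b) * _ + _.
pose I : finType := ('I_K * ('I_T * 'I_n))%type.
pose Z (p : I) o : R :=
  increment rho D eta (fun u => clamped_run p.1 u o) h b p.2.1 p.2.2.
have iZ p : Pr.-integrable setT (EFin \o Z p).
  by have [] := increment_mean p.1 p.2.1 p.2.2.
have hZ p : (\int[Pr]_o (Z p o)%:E <= cz%:E)%E.
  by have [] := increment_mean p.1 p.2.1 p.2.2.
have mN k : measurable_fun setT (fun o => (epoch_grad (val (k : 'I_K)) o)%:E).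
  by apply/measurable_EFinP; exact: measurable_epoch_grad.
have N0 k o : (0 <= (epoch_grad k o)%:E)%E by rewrite lee_fin enorm_ge0.
rewrite -ge0_integral_sum // -ge0_integralZl //; first last.
- by rewrite lee_fin mulr_ge0 // ltW.
- by move=> o _; apply: sume_ge0.
- exact: emeasurable_sum.
have iS : Pr.-integrable setT (fun o => \sum_(p : I) (Z p o)%:E)%E.
  by apply: integrable_sum => // p _; exact: iZ.
have iS' := integrableZl measurableT n%:R^-1 iS.
have iC : Pr.-integrable setT (cst (gam + K%:R * c0)%:E : Om -> \bar R).
  exact: finite_measure_integrable_cst.
have iR := integrableD measurableT iC iS'.
apply: (@le_trans _ _ (\int[Pr]_o ((gam + K%:R * c0)%:E +
    (n%:R^-1)%:E * \sum_(p : I) (Z p o)%:E))%E).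
  apply: ge0_le_integral => //.
  - move=> o _; apply: mule_ge0; last exact: sume_ge0.
    by rewrite lee_fin mulr_ge0 // ltW.
  - by apply: measurable_funeM; exact: emeasurable_sum.
  - exact: measurable_int iR.
  - move=> o _; rewrite !sumEFin -!EFinM -EFinD lee_fin.
    have := epochs_bound o; congr (_ <= _ + _ * _).
    transitivity (\sum_(k < K) \sum_(q : 'I_T * 'I_n) Z (k, q) o).
      by apply: eq_bigr => k _; rewrite pair_bigA.
    by rewrite pair_bigA; apply: eq_bigr => -[].
rewrite (integralD measurableT iC iS') integralZl //.
have -> : (\int[Pr]_o cst (gam + K%:R * c0)%:E o = (gam + K%:R * c0)%:E)%E.
  rewrite -[RHS]mule1 -(probability_setT Pr).
  exact: (integral_cst Pr measurableT).
rewrite integral_sum // [leRHS]EFinD; apply: leeD => //.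
apply: (@le_trans _ _ ((n%:R^-1)%:E * \sum_(p : I) cz%:E)%E).
  apply: lee_wpmul2l; first by rewrite lee_fin invr_ge0.
  exact: lee_sum.
rewrite sumEFin -EFinM lee_fin sumr_const card_prod card_prod !card_ord.
rewrite -[cz *+ _]mulr_natl !natrM le_eqVlt; apply/orP; left; apply/eqP; field.
by rewrite pnatr_eq0 -lt0n.
Qed.

End Expectation.

(** * Tuning of the epoch length and the learning rate *)

Section Tuning.
Context (R : realType).

Lemma nat_between (x : R) : 1 <= x ->
  exists2 m : nat, (0 < m)%N & x <= m%:R <= 2 * x.
Proof.
move=> x1; have x0 : 0 <= x by exact: le_trans x1.
have /andP[h1 h2] := truncn_itv x0.
exists (Num.truncn x).+1 => //; rewrite (ltW h2) /= -natr1.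
by move: h1 x1; lra.
Qed.

(** Comparing cubes removes the fractional powers. *)
Lemma powR_third_cube (q x : R) : 0 <= q -> 0 <= x ->
  (q `^ (1 / 3) * x `^ (2 / 3)) ^+ 3 = q * x ^+ 2.
Proof.
move=> q0 x0; rewrite exprMn -!powR_mulrn ?powR_ge0 // -!powRrM.
have -> : 1 / 3 * 3%:R = 1 :> R by field.
have -> : 2 / 3 * 3%:R = 2%:R :> R by field.
by rewrite powRr1 // powR_mulrn.
Qed.

(** [q^(1/3) (delta N)^(2/3)] has the order of [1 / (eps^2 q)], which is that
    of [T], when [N] has the order of [1 / (delta eps^3 q^2)]. *)
Lemma theta_cube (c C A B T N x q delta eps : R) : 1 <= A -> 1 <= B ->
  c = (16 * B ^+ 2)^-1 -> C = 8 * A * B ->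
  0 < q -> 0 < delta -> 0 < eps -> x = A / (eps ^+ 2 * q) ->
  x <= T <= 2 * x ->
  A * B / (delta * eps ^+ 3 * q ^+ 2) <= N <=
    4 * (A * B / (delta * eps ^+ 3 * q ^+ 2)) ->
  theta_between c C T (q `^ (1 / 3) * (delta * N) `^ (2 / 3)).
Proof.
move=> A1 B1 -> -> q0 d0 e0 -> /andP[T1 T2] /andP[N1 N2].
have A0 : 0 < A by exact: lt_le_trans A1.
have B0 : 0 < B by exact: lt_le_trans B1.
set r := _ * _ `^ _; have r0 : 0 <= r by rewrite mulr_ge0 ?powR_ge0.
pose w := (eps ^+ 3 * q ^+ 2)^-1.
have w0 : 0 < w by rewrite invr_gt0 mulr_gt0 ?exprn_gt0.
have dN1 : A * B * w <= delta * N.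
  have -> : A * B * w = delta * (A * B / (delta * eps ^+ 3 * q ^+ 2)).
    by rewrite /w; field; rewrite !lt0r_neq0.
  by rewrite ler_pM2l.
have dN2 : delta * N <= 4 * (A * B * w).
  have -> : 4 * (A * B * w) = delta * (4 * (A * B / (delta * eps ^+ 3 * q ^+ 2))).
    by rewrite /w; field; rewrite !lt0r_neq0.
  by rewrite ler_pM2l.
have ABw0 : 0 < A * B * w by rewrite !mulr_gt0.
have dN0 : 0 <= delta * N by rewrite (le_trans (ltW ABw0)).
have r3 : r ^+ 3 = q * (delta * N) ^+ 2 by exact: powR_third_cube (ltW q0) dN0.
pose v := A / (eps ^+ 2 * q); have v0 : 0 < v by rewrite divr_gt0 // mulr_gt0 ?exprn_gt0.
have T0 : 0 < T by exact: lt_le_trans T1.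
have v3 : v ^+ 3 * B ^+ 2 = A * (q * (A * B * w) ^+ 2).
  by rewrite /v /w; field; rewrite !lt0r_neq0.
have lo : q * (A * B * w) ^+ 2 <= r ^+ 3.
  by rewrite r3 ler_pM2l // ler_pXn2r ?nnegrE // ltW.
have hi : r ^+ 3 <= 16 * (q * (A * B * w) ^+ 2).
  have -> : 16 * (q * (A * B * w) ^+ 2) = q * (4 * (A * B * w)) ^+ 2 by ring.
  by rewrite r3 ler_pM2l // ler_pXn2r ?nnegrE // mulr_ge0 // ltW.
have T3 : v ^+ 3 <= T ^+ 3 by apply: lerXn2r T1; rewrite nnegrE ltW.
have T3' : T ^+ 3 <= 8 * v ^+ 3.
  have -> : 8 * v ^+ 3 = (2 * v) ^+ 3 by ring.
  apply: lerXn2r T2; rewrite nnegrE; first exact: ltW.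
  by rewrite mulr_ge0 //; exact: ltW v0.
have B2 : 1 <= B ^+ 2 by rewrite exprn_ege1.
have BB0 : 0 < 16 * B ^+ 2 by rewrite mulr_gt0 // exprn_gt0.
have cube (y1 y2 : R) : 0 <= y1 -> 0 <= y2 -> y1 ^+ 3 <= y2 ^+ 3 -> y1 <= y2.
  by move=> ? ?; rewrite ler_pXn2r.
apply/andP; split.
  apply: cube; [by rewrite mulr_ge0 // invr_ge0 ltW|exact: ltW|].
  rewrite exprMn exprVn ler_pdivrMl ?exprn_gt0 //.
  pose M := 16 * B ^+ 2; have M1 : 1 <= M by rewrite /M; lra.
  have rM : r ^+ 3 <= M * T ^+ 3.
    apply: le_trans hi _; apply: (@le_trans _ _ (M * v ^+ 3)).
      have -> : M * v ^+ 3 = 16 * (A * (q * (A * B * w) ^+ 2)).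
        by rewrite -v3 /M; ring.
      by rewrite ler_pM2l // ler_peMl // mulr_ge0 ?sqr_ge0 // ltW.
    by rewrite ler_pM2l // (lt_le_trans ltr01).
  apply: le_trans rM _; rewrite ler_wpM2r ?exprn_ge0 ?(ltW T0) //.
  exact: ler_eXnr.
have C0 : 0 <= 8 * A * B.
  by apply: mulr_ge0; [apply: mulr_ge0 => //|]; exact: ltW.
apply: cube; [exact: ltW|exact: mulr_ge0|].
apply: le_trans T3' _; rewrite [X in _ <= X]exprMn.
apply: (@le_trans _ _ (8 * A * B * r ^+ 3)).
  apply: (@le_trans _ _ (8 * (v ^+ 3 * B ^+ 2))).
    by rewrite ler_pM2l // ler_peMr // exprn_ge0 // ltW.
  rewrite v3 mulrA; apply: (@le_trans _ _ (8 * A * r ^+ 3)).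
    by rewrite ler_pM2l // mulr_gt0.
  rewrite ler_wpM2r ?exprn_ge0 // ler_peMr // mulr_ge0 // ltW //.
rewrite ler_wpM2r ?exprn_ge0 //; apply: ler_eXnr => //.
by rewrite -mulrA; nra.
Qed.

(** The final trade-off: with [p = sqrt T], [r = sqrt q] and [nu = sqrt n], each
    error term is at most a multiple of [p / r], which the length of the epoch
    turns into [p ^ 2 * eps]. *)
Lemma error_budget (a B K p r nu L sg2 G2 gam gamma delta eps D eta : R) :
  0 <= L -> 0 <= sg2 -> 0 <= G2 -> 1 <= nu ->
  a = 5 * (1 + L + sg2 + G2) -> B = 4 * nu * `|gamma| + 1 ->
  0 < r <= 1 -> 0 < delta < 1 -> 0 < eps < 1 ->
  a <= p * eps * r -> B <= K * (delta * eps * r ^+ 2) ->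
  D = delta * r ^+ 2 / (2 * p ^+ 2 * nu) -> eta = r * (D / p) -> gam <= gamma ->
  gam + K * (p ^+ 2 * (L * D ^+ 2 + 2 * L * (nu * D / r ^+ 2) * D) + D * p / 2
             + D ^+ 2 / (2 * eta))
    + K * (p ^+ 2 * (D / (2 * p) * sg2 + 5 / 2 * (eta / r ^+ 2) * G2))
  <= K * (D * p ^+ 2 * eps).
Proof.
move=> L0 s0 G0 nu1 aE BE /andP[r0 r1] /andP[d0 d1] /andP[e0 e1] ap BK DE etaE gg.
have nu0 : 0 < nu by exact: lt_le_trans nu1.
have a0 : 0 < a by rewrite aE; lra.
have p0 : 0 < p.
  have : 0 < p * eps * r by exact: lt_le_trans ap.
  by rewrite -mulrA pmulr_lgt0 // mulr_gt0.
have D0 : 0 < D by rewrite DE !(divr_gt0, mulr_gt0, exprn_gt0).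
have K0 : 0 < K.
  have B0 : 0 < B by rewrite BE ltr_wpDl // !mulr_ge0 // ltW.
  have : 0 < K * (delta * eps * r ^+ 2) by exact: lt_le_trans BK.
  by rewrite pmulr_lgt0 // !mulr_gt0 // exprn_gt0.
have p2D : p ^+ 2 * D = delta * r ^+ 2 / (2 * nu).
  by rewrite DE; field; rewrite !lt0r_neq0.
have hgam : gam <= K * (D * p ^+ 2 * eps) / 2.
  have -> : K * (D * p ^+ 2 * eps) / 2 = K * (delta * eps * r ^+ 2) / (4 * nu).
    by rewrite (mulrC D) p2D; field; rewrite lt0r_neq0.
  rewrite ler_pdivlMr ?mulr_gt0 //; apply: le_trans BK.
  apply: (@le_trans _ _ (`|gamma| * (4 * nu))); last by rewrite BE; lra.
  rewrite ler_wpM2r ?mulr_ge0 ?(ltW nu0) //.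
  by apply: le_trans gg _; exact: ler_norm.
pose t := p / r; have t0 : 0 < t by rewrite divr_gt0.
have pt : p <= t by rewrite ler_pdivlMr // ler_piMr // ltW.
have t1 : 1 <= t.
  have a1 : 1 <= a by rewrite aE; lra.
  have : p * eps * r <= p.
    rewrite -mulrA ler_piMr ?(ltW p0) //.
    by rewrite -[1]mulr1 ler_pM // ltW.
  by move: ap pt a1; lra.
have e1' : p ^+ 2 * (L * D ^+ 2 + 2 * L * (nu * D / r ^+ 2) * D) <= D * (2 * L * t).
  have -> : p ^+ 2 * (L * D ^+ 2 + 2 * L * (nu * D / r ^+ 2) * D) =
    D * (L * (p ^+ 2 * D + 2 * nu * (p ^+ 2 * D) / r ^+ 2)).
    by field; rewrite lt0r_neq0.
  rewrite ler_pM2l // p2D.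
  have -> : 2 * nu * (delta * r ^+ 2 / (2 * nu)) / r ^+ 2 = delta.
    by field; rewrite !lt0r_neq0.
  have : delta * r ^+ 2 / (2 * nu) <= 1.
    rewrite ler_pdivrMr ?mulr_gt0 // mul1r.
    have : r ^+ 2 <= 1 by rewrite expr_le1 // ltW.
    by move: d0 d1 nu1 r0; nra.
  have -> : 2 * L * t = L * (2 * t) by ring.
  by move=> hx; rewrite ler_wpM2l //; move: d1 t1; lra.
have e2 : D * p / 2 <= D * (t / 2).
  by rewrite -mulrA ler_pM2l // ler_pM2r.
have e3 : D ^+ 2 / (2 * eta) = D * (t / 2).
  by rewrite etaE /t; field; rewrite !lt0r_neq0.
have e4 : p ^+ 2 * (D / (2 * p) * sg2 + 5 / 2 * (eta / r ^+ 2) * G2) <=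
    D * (t * (sg2 / 2 + 5 / 2 * G2)).
  have -> : p ^+ 2 * (D / (2 * p) * sg2 + 5 / 2 * (eta / r ^+ 2) * G2) =
    D * (p * (sg2 / 2) + t * (5 / 2 * G2)).
    by rewrite etaE /t; field; rewrite !lt0r_neq0.
  by rewrite ler_pM2l // mulrDr lerD2r ler_wpM2r // divr_ge0.
have e5 : t * a <= p ^+ 2 * eps.
  rewrite /t mulrAC ler_pdivrMr //.
  have -> : p ^+ 2 * eps * r = p * (p * eps * r) by ring.
  by rewrite ler_pM2l.
have e6 : t * (2 * L + 1 + (sg2 / 2 + 5 / 2 * G2)) <= p ^+ 2 * eps / 2.
  have ha : (2 * L + 1 + (sg2 / 2 + 5 / 2 * G2)) * 2 <= a by rewrite aE; lra.
  by have := ler_wpM2l (ltW t0) ha; move: e5; lra.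
have e7 : D * (2 * L * t) + D * (t / 2) + D * (t / 2) +
   D * (t * (sg2 / 2 + 5 / 2 * G2)) <= D * p ^+ 2 * eps / 2.
  have -> : D * p ^+ 2 * eps / 2 = D * (p ^+ 2 * eps / 2) by ring.
  have -> : D * (2 * L * t) + D * (t / 2) + D * (t / 2) +
   D * (t * (sg2 / 2 + 5 / 2 * G2)) =
   D * (t * (2 * L + 1 + (sg2 / 2 + 5 / 2 * G2))) by field.
  by rewrite ler_pM2l.
rewrite -addrA -mulrDr.
have : K * (p ^+ 2 * (L * D ^+ 2 + 2 * L * (nu * D / r ^+ 2) * D) + D * p / 2
             + D ^+ 2 / (2 * eta)
    + p ^+ 2 * (D / (2 * p) * sg2 + 5 / 2 * (eta / r ^+ 2) * G2))
    <= K * (D * p ^+ 2 * eps / 2).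
  by rewrite ler_pM2l //; apply: le_trans e7; rewrite e3; lra.
by move: hgam; lra.
Qed.

End Tuning.

(** * Query points stay close to the average *)

Section Travel.
Context (R : realType) (n d : nat) (P : 'M[R]_n) (rho D eta : R).
Hypotheses (n_gt0 : (0 < n)%N) (D_gt0 : 0 < D).
Hypotheses (P_sym : P^T = P) (P_ds : doubly_stochastic P).
Hypotheses (P_rho : second_singular_value P rho) (rho01 : 0 <= rho < 1).
Variable S : nat -> state R n d.
Hypothesis S_traj : trajectory P D eta S.
Hypothesis y0_spread : spread (st_y (S 0)) <= (rho * tube n rho D) ^+ 2.

Lemma ybar_drift t u : enorm (ybar (S (t + u)) - ybar (S t)) <= u%:R * D.
Proof.
elim: u => [|u IH]; first by rewrite addn0 subrr enorm0 mul0r.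
rewrite addnS (ybarS P_ds S_traj) addrAC -natr1 mulrDl mul1r.
by apply: le_trans (enormD _ _) (lerD IH _); exact: abar_in.
Qed.

Lemma ybar_dist T t u : (t <= T)%N -> (u <= T)%N ->
  enorm (ybar (S t) - ybar (S u)) <= T%:R * D.
Proof.
wlog ut : t u / (u <= t)%N.
  move=> wl tT uT; have [h|h] := leqP u t; first exact: wl.
  by rewrite enormC; apply: wl => //; exact: ltnW.
move=> tT _; rewrite -(subnKC ut); apply: le_trans (ybar_drift _ _) _.
by rewrite ler_pM2r // ler_nat (leq_trans _ tT) // leq_subr.
Qed.

(** Within an epoch the average drifts by at most [D] per round, and the query
    points stay in the tube around it. *)
Lemma wbar_near T t : (0 < T)%N -> (t < T)%N ->
  enorm (ybar (S t) - ((n * T)%:R)^-1 *: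
    \sum_(i < n) \sum_(u < T) st_w (S u.+1) i) <= T%:R * D + tube n rho D.
Proof.
move=> T0 tT; set y := ybar (S t).
have nT0 : (n * T)%:R != 0 :> R by rewrite pnatr_eq0 -lt0n muln_gt0 n_gt0.
have -> : y - ((n * T)%:R)^-1 *: \sum_(i < n) \sum_(u < T) st_w (S u.+1) i =
    ((n * T)%:R)^-1 *: \sum_(i < n) \sum_(u < T) (y - st_w (S u.+1) i).
  under [in RHS]eq_bigr do rewrite sumrB sumr_const card_ord.
  rewrite sumrB sumr_const card_ord -mulrnA (mulnC T n) scalerBr.
  by rewrite -[y *+ _]scaler_nat scalerA mulVf // scale1r.
rewrite enormZ ger0_norm ?invr_ge0 // ler_pdivrMl ?ltr0n ?muln_gt0 ?n_gt0 //.
apply: le_trans (enorm_sum _ _ _) _.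
apply: (@le_trans _ _ (\sum_(i < n) \sum_(u < T) (T%:R * D + tube n rho D))).
  apply: ler_sum => i _; apply: le_trans (enorm_sum _ _ _) _.
  apply: ler_sum => u _; apply: le_trans (enorm_dist _ (ybar (S u)) _) _.
  apply: lerD; first by apply: ybar_dist; exact: ltnW.
  rewrite enormC.
  exact: (w_near_ybar n_gt0 D_gt0 P_sym P_ds P_rho rho01 S_traj u i y0_spread).
rewrite sumr_const card_ord sumr_const card_ord -mulrnA (mulnC T n).
by rewrite [X in _ <= X]mulr_natl.
Qed.

End Travel.

Section Sampling.
Context (R : realType).

Lemma clamp_id (r : R) : 0 <= r <= 1 -> clamp r = r.
Proof. by move=> /andP[r0 r1]; rewrite /clamp max_r // min_r. Qed.

Lemma uniform_ae01 (dO : measure_display) (Om : measurableType dO)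
    (Pr : probability Om R) (s : {mfun Om >-> R}) :
  has_law Pr s (uniform_prob (@ltr01 R)) -> {ae Pr, forall o, 0 <= s o <= 1}.
Proof.
move=> law; exists (s @^-1` (~` `[0, 1]%classic)).
have m01 : measurable (~` `[0, 1]%classic : set R).
  by apply: measurableC; exact: measurable_itv.
split.
- rewrite -[X in measurable X]setTI; exact: measurable_funP.
- rewrite law // /uniform_prob; apply: integral0_eq => x.
  rewrite /= in_itv /= => /negP h; rewrite /uniform_pdf.
  by rewrite (negPf h).
- by move=> o /=; rewrite in_itv.
Qed.

Lemma run_ext n d (P : 'M[R]_n) (D eta : R) (dX : 'I_n -> measure_display)
    (X : forall i, measurableType (dX i)) (F : forall i, 'rV[R]_d -> X i -> R)
    (s s' : nat -> nat -> 'I_n -> R) z xi K T k t :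
  (forall k t i, (k < K)%N -> (t < T)%N -> s k t i = s' k t i) ->
  (k < K)%N -> (t <= T)%N ->
  run P D eta F s z xi T k t = run P D eta F s' z xi T k t.
Proof.
move=> ss; have eepoch k' y0 u : (k' < K)%N -> (u <= T)%N ->
    epoch P D eta 0 F (s k') (z k') (xi k') y0 u =
    epoch P D eta 0 F (s' k') (z k') (xi k') y0 u.
  move=> kK; elim: u => [//|u IH] uT.
  have e : s k' u = s' k' u by apply/funext => i; exact: ss.
  have ltu := IH (ltnW uT).
  by rewrite [LHS]/= ltu e.
move=> kK tT; rewrite /run eepoch //.
have -> // : epoch_start P D eta 0 F s z xi T k =
  epoch_start P D eta 0 F s' z xi T k.
elim: k kK => [//|k IH] kK; have lk := ltnW kK.
by rewrite [LHS]/= (IH lk) (eepoch _ _ _ lk (leqnn T)).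
Qed.

Lemma wbar_ext n d (P : 'M[R]_n) (D eta : R) (dX : 'I_n -> measure_display)
    (X : forall i, measurableType (dX i)) (F : forall i, 'rV[R]_d -> X i -> R)
    (s s' : nat -> nat -> 'I_n -> R) z xi K T k :
  (forall k t i, (k < K)%N -> (t < T)%N -> s k t i = s' k t i) -> (k < K)%N ->
  me_dol_wbar P D eta 0 F s z xi T k = ((n * T)%:R)^-1 *:
    \sum_(i < n) \sum_(t < T) st_w (run P D eta F s' z xi T k t.+1) i.
Proof.
move=> ss kK; have -> : me_dol_wbar P D eta 0 F s z xi T k = ((n * T)%:R)^-1 *:
    \sum_(i < n) \sum_(t < T) st_w (run P D eta F s z xi T k t.+1) i by [].
under eq_bigr => i _ do under eq_bigr => t _ do
  rewrite (run_ext P D eta F z xi ss kK (ltn_ord t)).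
by [].
Qed.

End Sampling.

(** * Convergence *)

Unset Implicit Arguments.

Theorem theorem1 (R : realType) (n d : nat) (L L1 G sigma gamma : R)
    (n_gt0 : (0 < n)%N) :
  exists c C : R, [/\ 0 < c, 0 < C &
  forall (dX : 'I_n -> measure_display) (X : forall i, measurableType (dX i))
    (Q : forall i, probability (X i) R)
    (F : forall i, 'rV[R]_d -> X i -> R)
    (P : 'M[R]_n) (rho delta eps : R),
  let fi (i : 'I_n) (x : 'rV[R]_d) : R := fine ('E_(Q i)[F i x])%E in
  let f (x : 'rV[R]_d) : R := n%:R^-1 * \sum_(i < n) fi i x in
  (forall i x, (Q i).-integrable setT (EFin \o F i x)) ->
  (forall i, elipschitz L (fi i)) ->
  (forall i, smooth L1 (fi i)) ->
  connected_network P ->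
  P^T = P ->
  doubly_stochastic P ->
  second_singular_value P rho ->
  0 <= rho < 1 ->
  (forall i, has_lbound (range (fi i))) ->
  f 0 - inf (range f) <= gamma ->
  (forall i x, {ae Q i, forall u, differentiable (F i ^~ u) x}) ->
  (forall i j, measurable_fun setT (fun p : d.-tuple R * X i =>
     grad (F i ^~ p.2) (\row_l tnth p.1 l) 0 j)) ->
  (forall i x j,
     ('E_(Q i)[fun u => (grad (F i ^~ u) x 0 j)%R])%E
       = (grad (fi i) x 0 j)%:E) ->
  (forall i x,
     'E_(Q i)[fun u => (enorm (grad (F i ^~ u) x - grad (fi i) x) ^+ 2)%R]
       <= (sigma ^+ 2)%:E)%E ->
  (forall i x,
     'E_(Q i)[fun u => (enorm (grad (F i ^~ u) x) ^+ 2)%R]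
       <= (G ^+ 2)%:E)%E ->
  0 < delta < 1 ->
  0 < eps < 1 ->
  exists (K T : nat) (eta : R),
    let N := (K * T)%:R : R in
    let D := delta * (1 - rho) / (2 * T%:R * Num.sqrt n%:R) in
    [/\ (0 < K)%N /\ (0 < T)%N, 0 < eta,
        theta_between c C N (delta^-1 * eps ^- 3 * (1 - rho) ^- 2),
        theta_between c C T%:R
          ((1 - rho) `^ (1 / 3) * (delta * N) `^ (2 / 3)) &
        theta_between c C eta (Num.sqrt (1 - rho) * (D / Num.sqrt T%:R))] /\
    forall (dO : measure_display) (Om : measurableType dO)
      (Pr : probability Om R)
      (s : nat -> nat -> 'I_n -> {mfun Om >-> R})
      (z : nat -> nat -> 'I_n -> Om -> 'rV[R]_d)
      (xi : nat -> nat -> forall i, {mfun Om >-> X i}),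
    (forall k t i, (k < K)%N -> (t < T)%N ->
       has_law Pr (s k t i) (uniform_prob (@ltr01 R))) ->
    (forall k t i, (k < K)%N -> (t < T)%N -> has_law Pr (xi k t i) (Q i)) ->
    independent_sigma Pr (@draw_sigma R n K T dO Om dX X s xi) ->
    let wbar (k : nat) (o : Om) : 'rV[R]_d :=
      me_dol_wbar P D eta 0 F (fun k t i => s k t i o)
        (fun k t i => z k t i o) (fun k t i => xi k t i o) T k in
    ((K%:R^-1)%:E *
       \sum_(k < K) 'E_Pr[fun o => goldstein_norm f delta (wbar k o)]
       <= eps%:E)%E].
Proof.
(* The constants a and B are those of the error budget; T is about
   a^2 / (eps^2 q) and K about B / (delta eps q), rounded up. *)
pose a := 5 * (1 + `|L1| + sigma ^+ 2 + G ^+ 2).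
pose A := a ^+ 2; pose nu : R := Num.sqrt n%:R.
pose B := 4 * nu * `|gamma| + 1.
have nu1 : 1 <= nu by rewrite -[X in X <= _]sqrtr1 ler_sqrt ?ltr0n // ler1n.
have nu0 : 0 < nu by exact: lt_le_trans nu1.
have a1 : 1 <= a.
  rewrite /a; have := normr_ge0 L1; have := sqr_ge0 sigma; have := sqr_ge0 G.
  lra.
have a0 : 0 < a by exact: lt_le_trans a1.
have A1 : 1 <= A by rewrite exprn_ege1.
have A0 : 0 < A by exact: lt_le_trans A1.
have B1 : 1 <= B by rewrite lerDr !mulr_ge0 // ltW.
have B0 : 0 < B by exact: lt_le_trans B1.
pose c := (16 * B ^+ 2)^-1; pose C := 8 * A * B.
have B2 : 1 <= B ^+ 2 by rewrite exprn_ege1.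
have AB1 : 1 <= A * B by rewrite -[1]mulr1 ler_pM.
have c0 : 0 < c by rewrite invr_gt0; lra.
have c1 : c <= 1 by rewrite invf_le1; lra.
have C4 : 4 * (A * B) <= C by rewrite /C -mulrA; lra.
have C1 : 1 <= C by lra.
exists c, C; split => //; first by exact: lt_le_trans C1.
move=> dX X Q F P rho delta eps fi f _ _ smF _ Psym Pds Prho rho01 lb gap _ mF
  Fmean Fvar Fsec d01 e01.
have /andP[d0 d1] := d01; have /andP[e0 e1] := e01; have /andP[r0 r1] := rho01.
pose q := 1 - rho; have q0 : 0 < q by rewrite subr_gt0.
have q1 : q <= 1 by rewrite gerBl.
pose x := A / (eps ^+ 2 * q); pose y := B / (delta * eps * q).
have x1 : 1 <= x.
  rewrite ler_pdivlMr ?mul1r; last by rewrite mulr_gt0 // exprn_gt0.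
  apply: le_trans A1; rewrite -[1]mulr1 ler_pM ?sqr_ge0 ?(ltW q0) //.
  by rewrite exprn_ile1 // ltW.
have y1 : 1 <= y.
  rewrite ler_pdivlMr ?mul1r; last by rewrite !mulr_gt0.
  apply: le_trans B1; rewrite -[1]mulr1 ler_pM ?mulr_ge0 ?(ltW d0) ?(ltW e0) ?(ltW q0) //.
  by rewrite -[1]mulr1 ler_pM // ltW.
have [T T0 Tx] := nat_between x1; have [K K0 Ky] := nat_between y1.
have TR : 0 < T%:R :> R by rewrite ltr0n.
have KR : 0 < K%:R :> R by rewrite ltr0n.
pose D := delta * q / (2 * T%:R * nu).
have D0 : 0 < D by rewrite divr_gt0 ?mulr_gt0.
have travel : T%:R * D <= delta / 2.
  have -> : T%:R * D = delta / 2 * (q / nu).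
    by rewrite /D; field; rewrite !lt0r_neq0.
  have qnu : q / nu <= 1.
    by rewrite ler_pdivrMr // mul1r; exact: le_trans q1 nu1.
  by rewrite ler_piMr // divr_ge0 // ltW.
have width : tube n rho D <= delta / 2.
  have -> : tube n rho D = delta / 2 * T%:R^-1.
    by rewrite /tube -/q -/nu /D; field; rewrite !lt0r_neq0.
  have T1 : T%:R^-1 <= 1 :> R by rewrite invf_le1 // ler1n.
  by rewrite ler_piMr // divr_ge0 // ltW.
pose p : R := Num.sqrt T%:R; pose r := Num.sqrt q.
have p0 : 0 < p by rewrite sqrtr_gt0.
have r0' : 0 < r by rewrite sqrtr_gt0.
have p2 : p ^+ 2 = T%:R by rewrite sqr_sqrtr // ltW.
have r2 : r ^+ 2 = q by rewrite sqr_sqrtr // ltW.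
(* The learning rate sqrt q * D / sqrt T balances the two terms of the regret. *)
pose eta := r * (D / p).
have eta0 : 0 < eta by rewrite mulr_gt0 // divr_gt0.
pose w := (delta * eps ^+ 3 * q ^+ 2)^-1.
have w0 : 0 < w by rewrite invr_gt0 !mulr_gt0 ?exprn_gt0.
have yx : y * x = A * B * w.
  by rewrite /y /x /w; field; rewrite !lt0r_neq0.
have /andP[Tx1 Tx2] := Tx; have /andP[Ky1 Ky2] := Ky.
have N1 : A * B * w <= (K * T)%:R.
  by rewrite -yx natrM ler_pM // ?(le_trans ler01).
have N2 : (K * T)%:R <= 4 * (A * B * w).
  have -> : 4 * (A * B * w) = (2 * y) * (2 * x) by rewrite -yx; ring.
  by rewrite natrM ler_pM.
exists K, T, eta => N D'; split.
  split=> //.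
  - have -> : delta^-1 * eps ^- 3 * (1 - rho) ^- 2 = w.
      by rewrite /w -/q; field; rewrite !lt0r_neq0.
    apply/andP; split.
      apply: le_trans N1; rewrite ler_pM2r //; exact: le_trans c1 AB1.
    by apply: le_trans N2 _; rewrite mulrA ler_pM2r.
  - apply: (@theta_cube R c C A B T%:R N x q delta eps) => //.
    by apply/andP; split; [exact: N1|exact: N2].
  - apply/andP; split; first by rewrite ler_piMl // ltW.
    by rewrite ler_peMl // ltW.
move=> dO Om Pr s z xi slaw xilaw ind.
pose wbar (k : nat) (o : Om) : 'rV[R]_d :=
  me_dol_wbar P D eta 0 F (fun k t i => s k t i o) (fun k t i => z k t i o)
    (fun k t i => xi k t i o) T k.
change ((K%:R^-1)%:E * \sum_(k < K) 'E_Pr[fun o => goldstein_norm f delta (wbar k o)]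
  <= eps%:E)%E.
have smF' i : smooth `|L1| (fi i).
  have [df gl] := smF i; split=> // u v; apply: le_trans (gl u v) _.
  by rewrite ler_wpM2r ?enorm_ge0 // ler_norm.
have f_low u : inf (range f) <= f u.
  have /choice[m hm] := lb; apply: ge_inf; last by exists u.
  exists (n%:R^-1 * \sum_i m i) => _ [v _ <-].
  rewrite ler_wpM2l ?invr_ge0 //; apply: ler_sum => i _.
  by apply: hm; exists v.
have f_gap u : f 0 - f u <= f 0 - inf (range f) by rewrite lerD2l lerN2.
have df u : differentiable f u.
  by have [] := @grad_mean R d n fi u (fun i => proj1 (smF i)).
have := @expected_gradient R n d P rho D eta p sigma G `|L1| dX X Q F fi n_gt0 D0
  eta0 p0 rho01 mF Fmean Fvar Fsec dO Om Pr K T s z xi xilaw ind Psym Pds Prho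
  (normr_ge0 L1) smF' T0 _ f_gap.
set NN := (\sum_(k < K) _)%E => hN.
have budget := @error_budget R a B K%:R p r nu `|L1| (sigma ^+ 2) (G ^+ 2)
  (f 0 - inf (range f)) gamma delta eps D eta.
have hNN : (NN <= (K%:R * eps)%:E)%E.
  have DT0 : 0 < D * T%:R by rewrite mulr_gt0.
  have hN' : ((D * T%:R)%:E * NN <= (K%:R * (D * T%:R * eps))%:E)%E.
    apply: le_trans hN _; rewrite lee_fin.
    rewrite p2 r2 in budget; apply: budget => //.
    all: rewrite ?sqr_ge0 //.
    - by rewrite r0' -[X in _ <= X]sqrtr1 ler_wsqrtr.
    - have per0 : 0 <= p * eps * r by rewrite !mulr_ge0 // ltW.
      have perE : (p * eps * r) ^+ 2 = T%:R * (eps ^+ 2 * q).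
        by rewrite !exprMn p2 r2 mulrA.
      rewrite -(@ler_pXn2r _ 2) ?nnegrE ?(ltW a0) // perE.
      by rewrite -ler_pdivrMr ?mulr_gt0 ?exprn_gt0.
    - have deq0 : 0 < delta * eps * q by rewrite !mulr_gt0.
      by rewrite -(ler_pdivrMr _ _ deq0).
  rewrite -[NN]mul1e -(mulVf (lt0r_neq0 DT0)) EFinM -muleA.
  apply: le_trans (lee_wpmul2l _ hN') _; first by rewrite lee_fin invr_ge0 ltW.
  rewrite -EFinM lee_fin le_eqVlt; apply/orP; left; apply/eqP; field.
  by rewrite !lt0r_neq0.
(* Almost surely the clamped run is the run itself, and its averaged gradient is
   a Goldstein subgradient. *)
have golds (k : 'I_K) : ('E_Pr[fun o => goldstein_norm f delta (wbar k o)] <=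
   \int[Pr]_o (epoch_grad P D eta F fi T s z xi k o)%:E)%E.
  rewrite unlock; apply: ae_ge0_le_lower_integral.
  - move=> o; rewrite lee_fin.
    have near0 (t : 'I_1) : enorm (wbar k o - wbar k o) <= delta.
      by rewrite subrr enorm0 ltW.
    by have /andP[] := goldstein_norm_avg (isT : (0 < 1)%N) df near0.
  - by move=> o; rewrite lee_fin enorm_ge0.
  - apply/measurable_EFinP.
    exact: (measurable_epoch_grad P eta D0 mF Fmean T s z xi smF' k).
  have hs : {ae Pr, forall o, forall j : 'I_K * 'I_T * 'I_n,
      0 <= s j.1.1 j.1.2 j.2 o <= 1}.
    apply: filter_forall => j; apply: uniform_ae01; exact: slaw.
  apply: filterS hs => o ho; rewrite lee_fin.
  have wbarE : wbar k o = ((n * T)%:R)^-1 *: \sum_(i < n) \sum_(t < T)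
      st_w (clamped_run P D eta F T s z xi k t.+1 o) i.
    apply: (@wbar_ext R n d P D eta dX X F _ _ _ _ K T) => // k' t' i' lk lt.
    by rewrite clamp_id //; exact: (ho (Ordinal lk, Ordinal lt, i')).
  have tr := clamped_trajectory P eta F D0 T s z xi k o.
  have near_wbar (t : 'I_T) :
      enorm (ybar (clamped_run P D eta F T s z xi k t o) - wbar k o) <= delta.
    rewrite wbarE [delta]splitr; apply: le_trans (lerD travel width).
    apply: (wbar_near n_gt0 D0 Psym Pds Prho rho01 tr _ T0 (ltn_ord t)).
    exact: start_spread.
  by have /andP[_] := goldstein_norm_avg T0 df near_wbar.
apply: (@le_trans _ _ ((K%:R^-1)%:E * (K%:R * eps)%:E)%E); last first.
  by rewrite -EFinM mulKf ?lt0r_neq0.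
apply: lee_wpmul2l; first by rewrite lee_fin invr_ge0.
by apply: le_trans hNN; apply: lee_sum => k _; exact: golds.
Qed.
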